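(* Let $v$ be a valuation, with values in some abelian group, on the lattice of sets $\mathcal{L}$ generated by the (open, closed, half-open) cones in $\mathbb{R}^d$. For a convex polytope $\mathcal{P}\subset\mathbb{R}^d$ and positive integers $t$ let $$V_{\mathcal{P}}(t)=\sum_{\mathbf{m}\in\mathbb{Z}^d} v_{t\mathcal{P}}(\mathbf{m}).$$ Then for any closed convex rational $d$-polytope $\mathcal{P}$, $V_{\mathcal{P}}(t)$ is a quasi-polynomial in $t$ of degree $d$. The period of $V_{\mathcal{P}}(t)$ divides the denominator of $\mathcal{P}$. In particular, if $\mathcal{P}$ has integer vertices, then $V_{\mathcal{P}}$ is a polynomial. Its evaluation at negative integers gives $$V_{\mathcal{P}}(-t)=(-1)^d\,V_{-\mathcal{P}^\circ}(t).$$
   Context: A convex polyhedron is the intersection of (open or closed) half-spaces in $\mathbb{R}^d$. It is a convex polytope if it is bounded, and a cone if each hyperplane bounding the half-spaces that define it contains the origin. A $d$-polytope is a polytope of dimension $d$. A convex polytope is rational if its vertices have rational coordinates. A lattice of sets is a collection of sets, partially ordered by inclusion, that contains $A\cap B$ and $A\cup B$ whenever it contains $A$ and $B$. A valuation on a lattice of sets $\mathcal{L}$ is a function $v$ on $\mathcal{L}$ with values in some abelian group such that $v(A\cup B)=v(A)+v(B)-v(A\cap B)$ for all $A,B\in\mathcal{L}$. Let $1_X$ denote the characteristic function of a set $X$. For a convex polyhedron $\mathcal{P}$ and $\mathbf{m}\in\mathbb{Z}^d$, the tangent cone of $\mathcal{P}$ at $\mathbf{m}$ is $$\mathcal{K}_{\mathcal{P}}(\mathbf{m})=\Big\{\mathbf{x}\in\mathbb{R}^d:\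 \lim_{\epsilon\to0^+}1_{\mathcal{P}}(\mathbf{m}+\epsilon\mathbf{x})=1\Big\}.$$ One sets $v_{\mathcal{P}}(\mathbf{m})=v(\mathcal{K}_{\mathcal{P}}(\mathbf{m}))$. $\mathcal{P}^\circ$ denotes the relative interior of $\mathcal{P}$, $t\mathcal{P}=\{t\mathbf{x}:\mathbf{x}\in\mathcal{P}\}$, and $-\mathcal{P}^\circ=\{-\mathbf{x}:\mathbf{x}\in\mathcal{P}^\circ\}$. A quasi-polynomial of degree $d$ is an expression $Q(t)=c_d(t)\,t^d+\dots+c_1(t)\,t+c_0(t)$, where $c_0,c_1,\dots,c_d$ are periodic functions of $t$ and $c_d\not\equiv0$. The least common multiple of the periods of the $c_j$ is called the period of $Q$. The denominator of $\mathcal{P}$ is the least common multiple of the denominators of the vertices of $\mathcal{P}$. The function $V_{\mathcal{P}}$ is initially defined for positive integers $t$; its values at negative integers are those of the quasi-polynomial.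
   Formalization: Degree exactly d (c_d not identically 0) is claimed only when v(R^d) has infinite order, since it fails e.g. for v = 0; otherwise degree at most d. Also v(∅) = 0 is assumed, so that the sum over all m in Z^d is defined. *)

(* Defs.v *)
From HB Require Import structures.
From mathcomp Require Import all_boot all_order all_algebra.
From mathcomp Require Import all_classical all_reals all_analysis.

Set Implicit Arguments.
Unset Strict Implicit.
Unset Printing Implicit Defensive.

Import Order.TTheory GRing.Theory Num.Theory.
Import numFieldNormedType.Exports.

Local Open Scope classical_set_scope.
Local Open Scope ring_scope.

Section Polyhedra.
Variables (R : realType) (d : nat).
Local Notation E := 'rV[R]_d.
Implicit Types (P X Y : set E) (x y a m : E).

Definition dot a x : R := \sum_(i < d) a 0 i * x 0 i.

(* [strict] selects the open half-space. *)
Definition halfspace (strict : bool) a (b : R) : set E :=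
  [set x | dot a x < b ?<= if ~~ strict].

Definition halfspaces : set (set E) :=
  [set H | exists s a b, a != 0 /\ H = halfspace s a b].

Definition linear_halfspaces : set (set E) :=
  [set H | exists s a, a != 0 /\ H = halfspace s a 0].

(* Intersections of finitely many half-spaces; the empty family gives R^d. *)
Definition convex_polyhedron P := finI_from halfspaces id P.
Definition cone P := finI_from linear_halfspaces id P.
Definition convex_polytope P := convex_polyhedron P /\ bounded_set P.

Definition set_lattice (L : set (set E)) :=
  forall X Y, L X -> L Y -> L (X `&` Y) /\ L (X `|` Y).

Definition cone_lattice : set (set E) := smallest set_lattice cone.

(* [v] is total on [set E], but only its values on [L] are constrained. *)
Definition valuation (A : zmodType) (L : set (set E)) (v : set E -> A) :=
  forall X Y, L X -> L Y -> v (X `|` Y) = v X + v Y - v (X `&` Y).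

Definition affine_hull P : set E :=
  [set x | exists n (y : 'I_n -> E) (l : 'I_n -> R),
    [/\ forall i, P (y i), \sum_i l i = 1 & x = \sum_i l i *: y i]].

Definition has_dim P (k : nat) :=
  exists (x0 : E) (M : 'M[R]_(k, d)), row_free M /\
    affine_hull P = [set x0 + u *m M | u in [set: 'rV[R]_k]].

Definition relint P : set E :=
  [set x | P x /\ \forall y \near x, affine_hull P y -> P y].

(* A vertex is a zero-dimensional face: a supporting hyperplane meets [P]
   in that point only. *)
Definition vertex P x :=
  exists a (b : R), P `<=` [set y | dot a y <= b] /\
    P `&` [set y | dot a y = b] = [set x].

Definition ratv (q : 'rV[rat]_d) : E := map_mx ratr q.
Definition intv (z : 'rV[int]_d) : E := map_mx intr z.

Definition rational_vertices P := vertex P `<=` range ratv.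
Definition integral_vertices P := vertex P `<=` range intv.

Definition vec_denom (q : 'rV[rat]_d) : nat :=
  \big[lcmn/1%N]_(i < d) absz (denq (q 0 i)).

(* Meaningful when the vertices of [P] are rational, so that every vertex is
   [ratv q] for exactly one [q]. *)
Definition denominator P : nat :=
  \big[lcmn/1%N]_(q \in [set q | vertex P (ratv q)]) vec_denom q.

Definition dilate (t : nat) P : set E := [set t%:R *: x | x in P].
Definition opp_set P : set E := [set - x | x in P].

Definition tangent_cone P m : set E :=
  [set x | \1_P (m + e *: x) @[e --> (0 : R)^'+] --> (1 : R)].

(* The sum has finite support as soon as [P] is bounded and [v set0 = 0]. *)
Definition V (A : zmodType) (v : set E -> A) P (t : nat) : A :=
  \sum_(m \in [set: 'rV[int]_d]) v (tangent_cone (dilate t P) (intv m)).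

End Polyhedra.

Section QuasiPolynomials.

Definition has_period (T : Type) (c : int -> T) (p : nat) :=
  (0 < p)%N /\ forall t, c (t + p%:Z) = c t.

(* The least period, and 0 if [c] is not periodic. *)
Definition period (T : Type) (c : int -> T) : nat :=
  xget 0%N [set p | has_period c p /\ forall q, has_period c q -> (p <= q)%N].

(* Rational expressions c_d(t) t^d + ... + c_0(t); c_d may vanish. *)
Record quasi_poly (d : nat) := QuasiPoly {
  qp_coef : 'I_d.+1 -> int -> rat;
  qp_coef_periodic : forall j, exists p, has_period (qp_coef j) p }.

Definition qp_eval d (q : quasi_poly d) (t : int) : rat :=
  \sum_(j < d.+1) qp_coef q j t * t%:~R ^+ j.

(* In an abelian group A, an expression sum_j c_j(t) t^j only makes sense with
   c_j(t) in A (x) Q (already for A = int the coefficients are rational).  It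
   takes its values in A itself, torsion included, when it is a finite sum of
   terms q_i (x) a_i with a_i in A and q_i a rational quasi-polynomial that is
   integer-valued; then c_j(t) = sum_i (c_j of q_i)(t) (x) a_i.
   See [gqp_eval_additive]. *)
Record group_quasi_poly (A : zmodType) (d : nat) := GroupQuasiPoly {
  gqp_size : nat;
  gqp_elt : 'I_gqp_size -> A;
  gqp_fun : 'I_gqp_size -> quasi_poly d;
  gqp_int : forall i t, qp_eval (gqp_fun i) t \is a Num.int }.
Arguments gqp_elt {A d} _ _.
Arguments gqp_fun {A d} _ _.
Arguments gqp_int {A d} _ _ _.

Variables (A : zmodType) (d : nat).
Implicit Type Q : group_quasi_poly A d.

(* [numq] is the identity on integral rationals. *)
Definition gqp_eval Q (t : int) : A :=
  \sum_(i < gqp_size Q) gqp_elt Q i *~ numq (qp_eval (gqp_fun Q i) t).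

Definition gqp_coef Q (i : 'I_(gqp_size Q)) (j : 'I_d.+1) : int -> rat :=
  qp_coef (gqp_fun Q i) j.
Arguments gqp_coef : clear implicits.

Definition gqp_period Q : nat :=
  \big[lcmn/1%N]_(i < gqp_size Q) \big[lcmn/1%N]_(j < d.+1)
    period (gqp_coef Q i j).

(* sum_i c i (x) a i = 0 in A (x) Q: the sum vanishes in A after
   multiplication by a common multiple of the denominators. *)
Definition tensor_eq0 n (c : 'I_n -> rat) (a : 'I_n -> A) :=
  exists N : nat, [/\ (0 < N)%N, forall i, N%:R * c i \is a Num.int
    & \sum_(i < n) a i *~ numq (N%:R * c i) = 0].

(* c_d is not identically zero. *)
Definition gqp_degree_exact Q :=
  exists t, ~ tensor_eq0 (fun i => gqp_coef Q i ord_max t) (gqp_elt Q).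

Definition gqp_polynomial Q :=
  forall i j s t, gqp_coef Q i j s = gqp_coef Q i j t.

Lemma gqp_eval_additive (W : lmodType rat) (f : {additive A -> W}) Q t :
  f (gqp_eval Q t) =
  \sum_(j < d.+1)
    t%:~R ^+ j *: \sum_(i < gqp_size Q) gqp_coef Q i j t *: f (gqp_elt Q i).
Proof.
under [RHS]eq_bigr do rewrite scaler_sumr.
rewrite exchange_big raddf_sum; apply: eq_bigr => i _ /=.
under eq_bigr do rewrite scalerA mulrC.
rewrite -scaler_suml raddfMz -scaler_int -/(qp_eval _ _).
by have /intrP[z ->] := gqp_int Q i t; rewrite numq_int.
Qed.

End QuasiPolynomials.
Arguments gqp_coef {A d} _ _ _ _.

Definition infinite_order (A : zmodType) (a : A) :=
  forall N : nat, (0 < N)%N -> a *+ N <> 0.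

(* Main.v *)
(**
A regular triangulation of the cone over [P] in [R^(d+1)], induced by generic
heights [w] on the vertices, together with a generic interior direction [u],
cuts the cone into disjoint half-open simplicial cones: a point belongs to the
cell entered when it is moved slightly along [u].  Moving along [- u] instead
gives the interior of the cone as the disjoint union of the complementary
half-open cells.  Tangent cones inherit both decompositions, so [V] is a sum over
the cells, and only disjoint additivity of [v] is needed.  Inclusion-exclusion
over the facets of a cell [J] expresses the value at a lattice point with
vanishing coordinates [Z] by the values of the complementary cones
[K Y := meet Y (~` half J)], [Y] a subset of [Z]; hence both [V v P t] and
[V v (- int P) t] are combinations of the same [v (K Y)], with coefficients the
numbers of lattice points in the closed, respectively open, face [J \ Y] of the
dilated simplex.  Ehrhart reciprocity for simplices, obtained from the
fundamental parallelepiped and [binom(-x-1, k) = (-1)^k binom(x+k, k)], exchanges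
these two numbers.
*)

Require Import Defs.
From mathcomp Require Import all_boot all_order all_algebra.
From mathcomp Require Import finmap.
From mathcomp Require Import all_classical all_reals all_analysis.
From mathcomp Require Import zify ring lra.

Set Implicit Arguments.
Unset Strict Implicit.
Unset Printing Implicit Defensive.

Import Order.TTheory GRing.Theory Num.Theory.
Import numFieldNormedType.Exports.

Local Open Scope classical_set_scope.
Local Open Scope ring_scope.

(** * Basic solutions of linear programs *)

Section Perturbation.
Variables (R : realFieldType) (m : nat).
Implicit Types (f h : 'cV[R]_m) (u v : 'rV[R]_m).

(** Homogenising makes every dilate a slice of one fixed cone: $m \in tP$ becomes the point $(m,t)$,
    so a single triangulation serves all $t$, and a direction $y$ becomes a displacement $(y,0)$
    that acts on the coordinates of $(m,t)$ through lexicographic signs. The obstacle to reciprocity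
    is that $tP$ and $-tP^\circ$ have different tangent cones; the complementary cones are the
    common system in which the two can be compared. The signs then agree term by term:
    inclusion-exclusion contributes $(-1)^{|Y|}$, reciprocity for a face with $|J|-|Y|$ vertices
    contributes $(-1)^{|J|-|Y|-1}$, and $|J| = d+1$, so the product is always $(-1)^d$. Only the
    empty $Y$ reaches degree $d$, and its cone is the whole space; hence the degree depends on the
    order of [v setT]. As the group may have torsion, nothing is divided in it: all fractions stay
    inside integer-valued rational quasi-polynomials. *)

Lemma mulDZmx_ij p q r (u v : 'M[R]_(p, q)) (e : R) (M : 'M[R]_(q, r)) i j :
  ((u + e *: v) *m M) i j = (u *m M) i j + e * (v *m M) i j.
Proof. by rewrite mulmxDl -scalemxAl [LHS]mxE [X in _ + X]mxE. Qed.

Lemma perturb_pos (fs : seq 'cV[R]_m) u v :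
  (forall f, f \in fs -> 0 < (u *m f) 0 0) ->
  exists2 e : R, 0 < e & forall e', 0 < e' <= e ->
    forall f, f \in fs -> 0 < ((u + e' *: v) *m f) 0 0.
Proof.
elim: fs => [|f fs IH] H; first by exists 1.
have [|e1 e1_gt0 He1] := IH; first by move=> g gs; apply: H; rewrite inE gs orbT.
have f_gt0 : 0 < (u *m f) 0 0 by apply: H; rewrite inE eqxx.
set b := (v *m f) 0 0.
have b1 : 0 < `|b| + 1 by rewrite ltr_wpDl.
(* The [+ 1] keeps the denominator positive when [b] is 0, and halving leaves strict room. *)
exists (Num.min e1 ((u *m f) 0 0 / (`|b| + 1) / 2)).
  by rewrite lt_min e1_gt0 !divr_gt0.
move=> e' /andP[e'0]; rewrite le_min => /andP[e'1 e'2] g.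
rewrite inE => /orP[/eqP->|gs]; last by apply: He1 => //; rewrite e'0.
rewrite mulDZmx_ij -/b.
have : e' * (`|b| + 1) < (u *m f) 0 0.
  apply: le_lt_trans (_ : (u *m f) 0 0 / 2 < _); last by lra.
  by rewrite -ler_pdivlMr // mulrAC.
have : - (e' * `|b|) <= e' * b.
  by rewrite -mulrN ler_pM2l // lerNl -normrN ler_norm.
by rewrite mulrDr mulr1; lra.
Qed.

Lemma sqr_cV_gt0 h : h != 0 -> 0 < (h^T *m h) 0 0.
Proof.
move=> h0; rewrite mxE lt_neqAle eq_sym; apply/andP; split; last first.
  by apply: sumr_ge0 => i _; rewrite !mxE -expr2 sqr_ge0.
apply: contra h0; rewrite psumr_eq0 => [/allP H|i _]; last by rewrite mxE -expr2 sqr_ge0.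
apply/eqP/matrixP => i j; rewrite ord1 mxE.
by have := H i (mem_index_enum _); rewrite /= mxE mulf_eq0 orbb => /eqP.
Qed.

(* Once [u *m h] is made nonzero, its sign is recorded as one more strict
   inequality to be preserved by the later perturbations. *)
Lemma generic_vector (hs fs : seq 'cV[R]_m) u0 :
  (forall h, h \in hs -> h != 0) ->
  (forall f, f \in fs -> 0 < (u0 *m f) 0 0) ->
  exists u, (forall h, h \in hs -> (u *m h) 0 0 != 0) /\
            (forall f, f \in fs -> 0 < (u *m f) 0 0).
Proof.
elim: hs fs u0 => [|h hs IH] fs u0 Hh Hf; first by exists u0.
have h0 : h != 0 by apply: Hh; rewrite inE eqxx.
have {}Hh g : g \in hs -> g != 0 by move=> gs; apply: Hh; rewrite inE gs orbT.
suff [g [u1 [Hg]]] : exists g u1, (forall u, 0 < (u *m g) 0 0 -> (u *m h) 0 0 != 0)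
    /\ (forall f, f \in g :: fs -> 0 < (u1 *m f) 0 0).
  move=> /(IH _ _ Hh)[u [H1 H2]]; exists u; split=> f.
    rewrite inE => /orP[/eqP->|]; last exact: H1.
    by apply: Hg; apply: H2; rewrite inE eqxx.
  by move=> fs1; apply: H2; rewrite inE fs1 orbT.
have H g u1 : 0 < (u1 *m g) 0 0 -> (forall f, f \in fs -> 0 < (u1 *m f) 0 0) ->
    forall f, f \in g :: fs -> 0 < (u1 *m f) 0 0.
  by move=> ? K f; rewrite inE => /orP[/eqP->//|]; apply: K.
case: (ltrgtP ((u0 *m h) 0 0) 0) => hu.
- exists (- h), u0; split=> [u|]; last by apply: H => //; rewrite mulmxN mxE oppr_gt0.
  by rewrite mulmxN mxE oppr_gt0 => /lt_eqF->.
- by exists h, u0; split=> [u|]; [move=> /gt_eqF-> | apply: H].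
- have [e e0 He] := perturb_pos h^T Hf.
  exists h, (u0 + e *: h^T); split=> [u /gt_eqF->//|]; apply: H => //.
    by rewrite mulmxDl mxE hu add0r -scalemxAl mxE mulr_gt0 // sqr_cV_gt0.
  by apply: He; rewrite e0 lexx.
Qed.

End Perturbation.

(** * Finitely generated cones: optimal basic solutions, bases and coordinates *)

Section Triangulation.
Variables (R : realFieldType) (n m : nat) (G : 'M[R]_(n, m)) (h : 'cV[R]_m).
Hypothesis Gh : G *m h = const_mx 1.
Implicit Types (l c : 'rV[R]_n) (J : {set 'I_n}) (X : 'rV[R]_m).

Definition nonneg l := forall i, 0 <= l 0 i.
Definition supp l : {set 'I_n} := [set i | l 0 i != 0].
Definition indep J := forall c, supp c \subset J -> c *m G = 0 -> c = 0.
Definition in_cone X := exists2 l, nonneg l & l *m G = X.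

Lemma suppPn l i : i \notin supp l -> l 0 i = 0.
Proof. by rewrite inE negbK => /eqP. Qed.

(** The form [h] gives every generator height 1, so the coefficients of a relation sum to 0 and
    cannot all be nonpositive unless they vanish. *)
Lemma dependent_pos (c : 'rV[R]_n) : c *m G = 0 -> c != 0 -> exists i, 0 < c 0 i.
Proof.
move=> cG c0; apply/not_existsP => H; move/eqP: c0; apply.
have c_le0 i : c 0 i <= 0 by rewrite leNgt; apply/negP/H.
have : (c *m G *m h) 0 0 = 0 by rewrite cG mul0mx mxE.
rewrite -mulmxA Gh mxE => /eqP; rewrite -oppr_eq0 -sumrN psumr_eq0.
  move/allP => K; apply/matrixP => i j; rewrite ord1 [RHS]mxE.
  by have := K j (mem_index_enum _); rewrite /= mxE mulr1 oppr_eq0 => /eqP.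
by move=> i _; rewrite mxE mulr1 oppr_ge0.
Qed.

(** Caratheodory's argument with a cost: subtract a relation among the supporting generators,
    oriented so as not to raise the cost, until a coordinate vanishes. *)
Lemma basic_solution (w : 'cV[R]_n) l : nonneg l ->
  exists l', [/\ nonneg l', l' *m G = l *m G, (l' *m w) 0 0 <= (l *m w) 0 0
    & indep (supp l')].
Proof.
have [k] := ubnP #|supp l|; elim: k l => // k IH l lk l0.
have [ind|] := pselect (indep (supp l)); first by exists l.
move=> /existsNP[c0 /not_implyP[sc0 /not_implyP[cG0 c00]]].
have [c [sc cG cw [i0 ci0]]] : exists c, [/\ supp c \subset supp l, c *m G = 0,
    0 <= (c *m w) 0 0 & exists i, 0 < c 0 i].
  have [cw|cw] := leP 0 ((c0 *m w) 0 0).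
    by exists c0; split=> //; apply: dependent_pos cG0 _; apply/eqP.
  exists (- c0); split; last (apply: (@dependent_pos (- c0))).
  - suff -> : supp (- c0) = supp c0 by [].
    by apply/setP => i; rewrite !inE mxE oppr_eq0.
  - by rewrite mulNmx cG0 oppr0.
  - by rewrite mulNmx mxE oppr_ge0 ltW.
  - by rewrite mulNmx cG0 oppr0.
  - by rewrite oppr_eq0; apply/eqP.
(* Ratio test: the largest step that keeps [l - s *: c] nonnegative; it annihilates the coordinate
   [i1]. *)
pose i1 := [arg min_(i < i0 | 0 < c 0 i) (l 0 i / c 0 i)]%O.
have [ci1 mini1] : 0 < c 0 i1 /\ forall j, 0 < c 0 j -> l 0 i1 / c 0 i1 <= l 0 j / c 0 j.
  by rewrite /i1; case: arg_minP => // i ? H; split.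
set s := l 0 i1 / c 0 i1 in mini1.
have s0 : 0 <= s by rewrite divr_ge0 // ltW.
pose l1 := l - s *: c.
have l1i1 : l1 0 i1 = 0 by rewrite !mxE /s mulfVK ?subrr // gt_eqF.
have [||l' [l'0 l'G l'w l'ind]] := IH l1.
- rewrite (leq_trans _ (ltnSE lk)) // proper_card //; apply/properP; split.
    apply/fintype.subsetP => i; apply: contraLR => il.
    have /suppPn ci : i \notin supp c by apply: contra il => /(fintype.subsetP sc).
    by rewrite inE !mxE ci mulr0 subr0 suppPn // eqxx.
  exists i1; last by rewrite inE l1i1 eqxx.
  by apply: (fintype.subsetP sc); rewrite inE gt_eqF.
- move=> i; rewrite !mxE subr_ge0; have [ci|ci] := ltP 0 (c 0 i).
    by rewrite -ler_pdivlMr // mini1.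
  by apply: le_trans (l0 i); rewrite mulr_ge0_le0.
exists l'; split=> //; first by rewrite l'G mulmxBl -scalemxAl cG scaler0 subr0.
apply: le_trans l'w _; rewrite mulmxBl -scalemxAl mxE [X in _ + X]mxE [X in - X]mxE.
by rewrite gerBl mulr_ge0.
Qed.

(** A basic solution is determined by its support, so only finitely many candidates compete and the
    minimum is attained. *)
Lemma lp_optimum (w : 'cV[R]_n) l0 : nonneg l0 ->
  exists l, [/\ nonneg l, l *m G = l0 *m G, indep (supp l) &
    forall l', nonneg l' -> l' *m G = l0 *m G -> (l *m w) 0 0 <= (l' *m w) 0 0].
Proof.
move=> l00.
pose Q J : set 'rV[R]_n :=
  [set l | [/\ nonneg l, l *m G = l0 *m G, indep (supp l) & supp l = J]].
pose f J := xget 0 (Q J).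
have Qf l : nonneg l -> l *m G = l0 *m G -> indep (supp l) -> Q (supp l) (f (supp l)).
  by move=> *; apply: (@xgetPex _ 0 (Q (supp l))); exists l.
have [l1 [l10 l1G _ l1i]] := basic_solution w l00.
pose P J := `[< Q J (f J) >].
have PJ1 : P (supp l1) by apply/asboolP; apply: Qf.
have [J /asboolP[fJ0 fJG fJi fJs] Jmin] :=
  arg_minP (fun J => (f J *m w) 0 0) PJ1.
exists (f J); split=> // l' l'0 l'G.
have [l2 [l20 l2G l2w l2i]] := basic_solution w l'0.
have Ql2 : Q (supp l2) (f (supp l2)) by apply: Qf => //; rewrite l2G.
apply: le_trans l2w; suff <- : f (supp l2) = l2 by apply: Jmin; apply/asboolP.
case: Ql2 => _ fG _ fs; apply/eqP; rewrite -subr_eq0; apply/eqP/l2i.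
  apply/fintype.subsetP => i; apply: contraLR => il2.
  have := il2; rewrite -{1}fs => /suppPn; move/suppPn: il2.
  by rewrite inE !mxE => -> ->; rewrite subrr eqxx.
by rewrite mulmxBl fG l2G l'G subrr.
Qed.

(** Rows outside [J] are zeroed instead of removed, so that all [J] share one matrix type;
    [row_full] then says that the generators in [J] span. *)
Definition maskmx J := \matrix_(i, j) (G i j *+ (i \in J)).

Lemma mask_mul J (v : 'cV[R]_m) :
  (forall i, i \in J -> (G *m v) i 0 = 0) <-> maskmx J *m v = 0.
Proof.
have E i : (maskmx J *m v) i 0 = (G *m v) i 0 *+ (i \in J).
  rewrite !mxE -sumrMnl; apply: eq_bigr => j _; rewrite !mxE.
  by case: (i \in J); rewrite ?mulr1n // !mulr0n mul0r.
split=> [H|H i iJ]; last by have := E i; rewrite iJ mulr1n => <-; rewrite H mxE.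
apply/matrixP => i j; rewrite (ord1 j) E [RHS]mxE.
by case iJ: (i \in J); rewrite ?mulr0n // mulr1n H.
Qed.

Definition annihilator J : 'cV[R]_m :=
  xget 0 [set v | v != 0 /\ forall i, i \in J -> (G *m v) i 0 = 0].

Lemma annihilatorP J : ~~ row_full (maskmx J) ->
  annihilator J != 0 /\ forall i, i \in J -> (G *m annihilator J) i 0 = 0.
Proof.
move=> nf; apply: (@xgetPex _ 0
  [set v : 'cV[R]_m | v != 0 /\ forall i, i \in J -> (G *m v) i 0 = 0]).
have : cokermx (maskmx J) != 0.
  rewrite -mxrank_eq0 mxrank_coker subn_eq0 -ltnNge ltn_neqAle rank_leq_col andbT.
  exact: nf.
move=> /matrix0Pn[i [j cij]]; exists (col j (cokermx (maskmx J))); split.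
  by apply/matrix0Pn; exists i, 0; rewrite [X in X != 0]mxE.
by apply: (mask_mul _ _).2; rewrite colE mulmxA mulmx_coker mul0mx.
Qed.

Lemma annihilator_full J (v : 'cV[R]_m) : v != 0 -> (forall i, i \in J -> (G *m v) i 0 = 0) ->
  ~~ row_full (maskmx J).
Proof.
move=> v0 /(mask_mul J v).1 Jv; apply: contra v0 => /row_fullP[B BM].
by rewrite -[v]mul1mx -BM -mulmxA Jv mulmx0.
Qed.

(** Avoiding one chosen hyperplane through each non-spanning set of generators keeps [X] out of the
    span of every such set. *)
Definition generic X := forall J, ~~ row_full (maskmx J) ->
  (X *m annihilator J) 0 0 != 0.

(** [X *m L] lists the coordinates of [X] in the basis formed by the rows of [G] in [J], padded with
    zeros outside [J]. *)
Definition is_basis J (L : 'M[R]_(m, n)) :=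
  [/\ L *m G = 1%:M, forall k j, j \notin J -> L k j = 0
    & forall i k, i \in J -> (G *m L) i k = (i == k)%:R].

Definition coord J : 'M[R]_(m, n) := xget 0 [set L | is_basis J L].

Lemma is_basis_supp J L l : is_basis J L -> supp l \subset J -> l *m G *m L = l.
Proof.
move=> [_ _ GL] sl; apply/matrixP => i k; rewrite (ord1 i) -mulmxA mxE (bigD1 k) //=.
rewrite big1 => [|j jk].
  rewrite addr0; have [ks|/suppPn->] := boolP (k \in supp l); last by rewrite mul0r.
  by rewrite GL ?(fintype.subsetP sl) // eqxx mulr1.
have [ks|/suppPn->] := boolP (j \in supp l); last by rewrite mul0r.
by rewrite GL ?(fintype.subsetP sl) // (negPf jk) mulr0.
Qed.

Lemma is_basis_coord J L : is_basis J L -> is_basis J (coord J).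
Proof. by move=> JL; rewrite /coord; case: xgetP => [M _ //|/(_ L)]. Qed.

Lemma indep_full_basis J : indep J -> row_full (maskmx J) -> is_basis J (coord J).
Proof.
move=> Ji /row_fullP[B BM].
pose L := \matrix_(k, j) (B k j *+ (j \in J)).
have LG : L *m G = 1%:M.
  rewrite -BM; apply/matrixP => i j; rewrite !mxE; apply: eq_bigr => k _; rewrite !mxE.
  by case: (k \in J); rewrite ?mulr1n // !mulr0n mul0r mulr0.
apply: (@is_basis_coord J L); split=> // [k j /negPf jJ|i k iJ].
  by rewrite mxE jJ.
suff : row i G *m L = delta_mx 0 i.
  by rewrite -row_mul => /matrixP/(_ 0 k); rewrite [LHS]mxE => ->; rewrite mxE eqxx eq_sym.
apply/eqP; rewrite -subr_eq0; apply/eqP/Ji.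
  apply/fintype.subsetP => j; apply: contraLR => jJ; rewrite inE negbK !mxE eqxx /=.
  rewrite big1 => [|k' _]; last by rewrite [L _ _]mxE (negPf jJ) mulr0.
  by rewrite sub0r oppr_eq0; have /negPf-> : j != i by apply: contraNneq jJ => ->.
by rewrite mulmxBl -mulmxA LG mulmx1 -rowE subrr.
Qed.

(** Compare traces: that of [L *m G] is [m], while the diagonal of [G *m L] is the indicator of
    [J]. *)
Lemma card_basis J L : is_basis J L -> #|J| = m.
Proof.
move=> [LG L0 GL]; have := mxtrace_mulC L G; rewrite LG mxtrace1 /mxtrace.
rewrite [X in _ = X -> _](bigID (mem J)) /= [X in _ + X]big1 => [|i iJ].
  under eq_bigr => i iJ do rewrite GL // eqxx.
  by rewrite addr0 -natr_sum sum1_card => /eqP; rewrite eqr_nat => /eqP.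
by rewrite mxE big1 // => k _; rewrite L0 // mulr0.
Qed.

(** No lifted generator lies on the hyperplane through the lifts of a basis [J] that omits it. If
    [J] is not a basis, [coord] is 0 and the condition only asks [w i 0] to be nonzero. *)
Definition generic_cost (w : 'cV[R]_n) := forall J i,
  i \notin J -> (G *m coord J *m w) i 0 != w i 0.

End Triangulation.

(** * Regular triangulations *)

Section RegularTriangulation.
Variables (R : realFieldType) (n m : nat) (G : 'M[R]_(n, m)) (h : 'cV[R]_m).
Hypothesis Gh : G *m h = const_mx 1.
Implicit Types (J : {set 'I_n}) (X : 'rV[R]_m).

Lemma coord_off J k j : j \notin J -> coord G J k j = 0.
Proof.
move=> jJ; rewrite /coord; case: xgetP => [M _ [_ M0 _]|_]; first exact: M0.
by rewrite mxE.
Qed.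

(** Each condition says that a linear form in [w] does not vanish. The form is nonzero: its
    coefficient at [i] is 1, since column [i] of [coord G J] is zero for [i] outside [J]. *)
Lemma generic_cost_exists : exists w, generic_cost G w.
Proof.
pose f (p : {set 'I_n} * 'I_n) : 'cV[R]_n :=
  (delta_mx 0 p.2 - row p.2 (G *m coord G p.1))^T.
pose hs := [seq f p | p : {set 'I_n} * 'I_n <- enum {: {set 'I_n} * 'I_n} & p.2 \notin p.1].
have [|//|u [Hu _]] := @generic_vector _ _ hs [::] 0.
  move=> g /mapP[[J i]]; rewrite mem_filter /= => /andP[iJ _] ->.
  apply/eqP => /matrixP/(_ i 0); rewrite !mxE !eqxx big1 => [|k _].
    by rewrite subr0; apply/eqP/oner_neq0.
  by rewrite coord_off // mulr0.
exists u^T => J i iJ.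
have /Hu : f (J, i) \in hs by apply: map_f; rewrite mem_filter iJ mem_enum.
rewrite -[u in u *m _]trmxK -trmx_mul mxE mulmxBl -rowE -row_mul.
by rewrite [X in X != _]mxE [X in X + _]mxE [X in _ + X]mxE [X in _ - X]mxE subr_eq0 eq_sym.
Qed.

Lemma generic_exists (fs : seq 'cV[R]_m) (u0 : 'rV[R]_m) :
  (forall f, f \in fs -> 0 < (u0 *m f) 0 0) ->
  exists2 u, generic G u & forall f, f \in fs -> 0 < (u *m f) 0 0.
Proof.
pose hs := [seq annihilator G J | J <- enum {set 'I_n} & ~~ row_full (maskmx G J)].
move=> /(generic_vector (hs := hs))[|u [Hu1 Hu2]].
  by move=> g /mapP[J]; rewrite mem_filter => /andP[Jf _] ->; have [] := annihilatorP Jf.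
exists u => // J Jf; apply: Hu1; apply: map_f.
by rewrite mem_filter Jf mem_enum.
Qed.

Lemma is_basisM J X : is_basis G J (coord G J) -> X *m coord G J *m G = X.
Proof. by case=> CG _ _; rewrite -mulmxA CG mulmx1. Qed.

(** If the coordinate at [j] vanished, [X] would lie in the span of [J :\ j], which is proper
    because column [j] of [coord G J] annihilates it. *)
Lemma generic_coord J X j : is_basis G J (coord G J) -> generic G X -> j \in J ->
  (X *m coord G J) 0 j != 0.
Proof.
move=> bJ gX jJ; have [CG C0 GC] := bJ.
have nf : ~~ row_full (maskmx G (J :\ j)).
  apply: (@annihilator_full _ _ _ _ _ (col j (coord G J))).
    apply/eqP => E; have := GC j j jJ; rewrite eqxx mxE big1 => [/eqP|k _].
      by rewrite eq_sym oner_eq0.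
    by have /matrixP/(_ k 0) := E; rewrite mxE => ->; rewrite mxE mulr0.
  move=> i; rewrite !inE => /andP[ij iJ].
  by rewrite colE mulmxA -colE mxE GC // (negPf ij).
apply: contraNneq (gX _ nf) => Xj0; have [_ ann] := annihilatorP nf.
rewrite -(is_basisM X bJ) -mulmxA mxE big1 // => k _.
have [->|kj] := eqVneq k j; first by rewrite Xj0 mul0r.
have [kJ|kJ] := boolP (k \in J); first by rewrite ann ?mulr0 // !inE kj.
by rewrite mxE big1 ?mul0r // => i _; rewrite C0 // mulr0.
Qed.

Variable w : 'cV[R]_n.
Hypothesis gw : generic_cost G w.

(* The simplices of the regular triangulation induced by the heights [w]: the
   linear form agreeing with [w] on [J] lies strictly below [w] elsewhere. *)
Definition simplices : {set {set 'I_n}} :=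
  [set J | `[< is_basis G J (coord G J) /\
    forall i, i \notin J -> (G *m coord G J *m w) i 0 < w i 0 >]].

Lemma simplices_basis J : J \in simplices -> is_basis G J (coord G J).
Proof. by rewrite inE => /asboolP[]. Qed.

Lemma simplices_le J i : J \in simplices ->
  (G *m coord G J *m w) i 0 <= w i 0 ?= iff (i \in J).
Proof.
move=> JS; have [iJ|iJ] := boolP (i \in J); last first.
  move: JS; rewrite inE => /asboolP[_ /(_ i iJ) lt].
  by split; rewrite ?(ltW lt) ?(lt_eqF lt).
suff -> : (G *m coord G J *m w) i 0 = w i 0 by exact/leif_refl.
have [_ _ GC] := simplices_basis JS.
rewrite mxE (bigD1 i) //= GC // eqxx mul1r big1 ?addr0 // => k ki.
by rewrite GC // eq_sym (negPf ki) mul0r.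
Qed.

(** The simplex is the support of an optimal solution for the cost [w]: genericity of [X] makes this
    support a basis, optimality makes the reduced costs of the other generators nonnegative, and
    genericity of [w] makes them positive. *)
Lemma simplices_exist X : generic G X -> in_cone G X ->
  exists2 J, J \in simplices & forall j, j \in J -> 0 < (X *m coord G J) 0 j.
Proof.
move=> gX [l0 l00 l0X]; have [l [lpos lG li lmin]] := lp_optimum Gh w l00.
set J := supp l in li; rewrite l0X in lG lmin.
have fJ : row_full (maskmx G J).
  apply/negPn/negP => nf; have [_ ann] := annihilatorP nf.
  move/eqP: (gX _ nf); apply; rewrite -lG -mulmxA mxE big1 // => i _.
  have [iJ|/suppPn->] := boolP (i \in J); last by rewrite mul0r.
  by rewrite ann ?mulr0.
have bJ := indep_full_basis li fJ; have [CG C0 GC] := bJ.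
have lE : X *m coord G J = l by rewrite -lG (is_basis_supp bJ) // fintype.subxx.
have l_gt0 j : j \in J -> 0 < l 0 j by rewrite inE lt_neqAle lpos andbT eq_sym.
exists J; last by move=> j jJ; rewrite lE l_gt0.
rewrite inE; apply/asboolP; split=> // i iJ; rewrite lt_neqAle gw //=.
(* The relation that introduces generator [i] and compensates along [J]; its cost is the reduced
   cost of [i]. *)
pose c := delta_mx 0 i - row i (G *m coord G J).
have cG : c *m G = 0.
  by rewrite mulmxBl -rowE row_mul -mulmxA CG mulmx1 subrr.
pose fs : seq 'cV[R]_n := [seq delta_mx j 0 | j <- enum J].
have dE (v : 'rV[R]_n) j : (v *m delta_mx j (0 : 'I_1)) 0 0 = v 0 j.
  by rewrite -colE mxE.
have [|e e0 He] := @perturb_pos _ _ fs l c.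
  by move=> g /mapP[j]; rewrite mem_enum => jJ ->; rewrite dE l_gt0.
have lcG : (l + e *: c) *m G = X by rewrite mulmxDl -scalemxAl cG scaler0 addr0.
have lc0 : nonneg (l + e *: c).
  move=> j; have [jJ|jJ] := boolP (j \in J).
    apply/ltW; have := He e; rewrite e0 lexx => /(_ isT (delta_mx j 0)); rewrite dE; apply.
    by apply: map_f; rewrite mem_enum.
  rewrite !mxE eqxx big1 => [|k _]; last by rewrite C0 // mulr0.
  by rewrite subr0 addr_ge0 // ?mulr_ge0 ?ler0n // ltW.
have := lmin _ lc0 lcG; rewrite mulDZmx_ij lerDl pmulr_rge0 // mulmxBl -rowE -row_mul.
by rewrite [X in 0 <= X]mxE [X in X + _]mxE [X in _ + X]mxE [X in - X]mxE subr_ge0.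
Qed.

(** The linear form interpolating [w] on [J'] lies below [w], with equality exactly on [J']; pair it
    with the coordinates of [X] in [J], all positive there. *)
Lemma simplices_cost J J' X : J \in simplices -> J' \in simplices ->
  (forall j, j \in J -> 0 < (X *m coord G J) 0 j) ->
  (X *m coord G J' *m w) 0 0 <= (X *m coord G J *m w) 0 0 ?= iff (J \subset J').
Proof.
move=> JS JS' pos; set l := X *m coord G J in pos *.
have lX : l *m G = X by apply/is_basisM/simplices_basis.
have -> : (X *m coord G J' *m w) 0 0 = \sum_i l 0 i * (G *m coord G J' *m w) i 0.
  by rewrite -[in LHS]lX -(mulmxA l) -(mulmxA l) mxE.
rewrite [X in _ <= X ?= iff _]mxE.
have -> : (J \subset J') = [forall (i | true), (i \in J) ==> (i \in J')].
  apply/fintype.subsetP/forallP => H i; last by have := H i; rewrite /= => /implyP.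
  by apply/implyP => _; apply/implyP/H.
apply: leif_sum => i _.
have [iJ|iJ] := boolP (i \in J); last first.
  by rewrite [l 0 i]mxE big1 ?mul0r => [|k _]; [apply/leif_refl | rewrite coord_off ?mulr0].
have [le eq] := simplices_le i JS'; have l0 := pos i iJ.
by split; rewrite ?ler_pM2l // (inj_eq (mulfI (lt0r_neq0 l0))) eq.
Qed.

(** Each cost bounds the other, so they are equal, and the equality cases of [simplices_cost] give
    both inclusions. *)
Lemma simplices_unique J J' X : J \in simplices -> J' \in simplices ->
  (forall j, j \in J -> 0 < (X *m coord G J) 0 j) ->
  (forall j, j \in J' -> 0 < (X *m coord G J') 0 j) -> J = J'.
Proof.
move=> JS JS' pos pos'; have [le1 eq1] := simplices_cost JS JS' pos.
have [le2 eq2] := simplices_cost JS' JS pos'.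
apply/eqP; rewrite finset.eqEsubset -eq1 -eq2 [X in _ && X]eq_sym andbb.
by rewrite eq_le le1.
Qed.

End RegularTriangulation.

(** * Half-open decomposition *)

Section LexicographicSign.
Variable R : realType.
Implicit Types (a b e : R) (s : bool).

(* The sign of [a + e * b] for infinitesimal [e > 0]. *)
Definition lexpos s a b := (0 < a) || (a == 0) && (0 < b ?<= if s).

Lemma near_lexpos s a b :
  \forall e \near 0^'+, (0 < a + e * b ?<= if s) = lexpos s a b.
Proof.
have b1 : 0 < `|b| + 1 by rewrite ltr_wpDl.
have bound e : 0 < e -> e < `|a| / (`|b| + 1) -> a != 0 -> `|e * b| < `|a|.
  move=> e0; rewrite ltr_pdivlMr // => ea a0; apply: le_lt_trans ea.
  by rewrite normrM gtr0_norm // ler_pM2l // lerDl.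
rewrite /lexpos; have [->|a0] := eqVneq a 0.
  near=> e; have e0 : 0 < e by near: e; exact: nbhs_right_gt.
  by rewrite ltxx add0r /=; case: s; rewrite /= ?pmulr_rge0 ?pmulr_rgt0.
near=> e.
have e0 : 0 < e by near: e; exact: nbhs_right_gt.
have /(bound e e0)/(_ a0) : e < `|a| / (`|b| + 1).
  by near: e; apply: nbhs_right_lt; rewrite divr_gt0 // normr_gt0.
rewrite orbF ltr_norml => /andP[l1 l2].
have [a1|a1|a1] := ltrgtP a 0; last by move: (a0); rewrite a1 eqxx.
  move: l2; rewrite ltr0_norm // => l2.
  by apply/negbTE; case: s; rewrite /= -?ltNge -?leNgt; lra.
by apply: lteifS; move: l1; rewrite gtr0_norm //; lra.
Unshelve. all: by end_near. Qed.

Lemma near_neq0 a b : b != 0 -> \forall e \near 0^'+, a + e * b != 0.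
Proof.
move=> b0; near=> e; have e0 : 0 < e by near: e; exact: nbhs_right_gt.
have E1 : (0 < a + e * b ?<= if false) = lexpos false a b by near: e; exact: near_lexpos.
have E2 : (0 < - a + e * - b ?<= if false) = lexpos false (- a) (- b).
  by near: e; exact: near_lexpos.
rewrite neq_lt orbC; move: E1 E2; rewrite /= mulrN -opprD oppr_gt0 /lexpos => -> ->.
rewrite /= !oppr_gt0 oppr_eq0.
case: (ltrgtP a 0) => //= _; move: (b0); case: (ltrgtP b 0).
Unshelve. all: by end_near. Qed.

(** A nonzero infinitesimal part turns a strict inequality into a strict or weak one on [a] alone,
    depending on its sign; this is the origin of the flags in [cell]. *)
Lemma lexpos_sign (o : bool) a b : b != 0 ->
  lexpos false a ((-1) ^+ o * b) = (0 < a ?<= if (0 < b) (+) o).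
Proof.
move=> b0; rewrite /lexpos; case: o; rewrite ?expr0 ?expr1 ?mul1r ?mulN1r /= ?oppr_gt0.
  by rewrite addbT; case: (ltrgtP b 0) b0 => //= _ _; case: (ltrgtP a 0).
by rewrite addbF; case: (ltrgtP b 0) b0 => //= _ _; case: (ltrgtP a 0).
Qed.

End LexicographicSign.

(** * Half-open cells of the cone and of its interior, and their tangent cones *)

Section HalfOpenCells.
Variables (R : realType) (n m : nat) (G : 'M[R]_(n, m)) (h : 'cV[R]_m).
Hypothesis Gh : G *m h = const_mx 1.
Variable w : 'cV[R]_n.
Hypothesis gw : generic_cost G w.
Variable fs : seq 'cV[R]_m.
Implicit Types (J : {set 'I_n}) (X Y M : 'rV[R]_m) (o : bool).

Definition in_interior X := forall f, f \in fs -> 0 < (X *m f) 0 0.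

Hypothesis interior_cone : forall X, in_interior X -> in_cone G X.
Hypothesis cone_ge0 : forall X, in_cone G X -> forall f, f \in fs -> 0 <= (X *m f) 0 0.

Variable u : 'rV[R]_m.
Hypotheses (gu : generic G u) (iu : in_interior u).

Local Notation S := (simplices G w).
Local Notation bc X J j := ((X *m coord G J) 0 j).

(* The half-open cone over [J] containing the points that enter its interior
   when moved slightly in the direction [u] (or [- u] if [o]). *)
Definition cell o J X :=
  [forall (j | j \in J), 0 < bc X J j ?<= if (0 < bc u J j) (+) o].

Lemma near_cell o J X : J \in S ->
  \forall e \near (0 : R)^'+, [forall (j | j \in J), 0 < bc (X + e *: ((-1) ^+ o *: u)) J j]
    = cell o J X.
Proof.
move=> JS.
suff : \forall e \near (0 : R)^'+, forall j, j \in J ->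
    (0 < bc (X + e *: ((-1) ^+ o *: u)) J j) = (0 < bc X J j ?<= if (0 < bc u J j) (+) o).
  apply: filterS => e H.
  by apply: eq_forallb => j; case jJ: (j \in J) => //=; rewrite H.
apply: filter_forall => j; near=> e => jJ.
have E : (0 < bc X J j + e * ((-1) ^+ o * bc u J j) ?<= if false) =
  lexpos false (bc X J j) ((-1) ^+ o * bc u J j) by near: e; exact: near_lexpos.
rewrite mulDZmx_ij -scalemxAl [X in _ * X]mxE; move: E => /= ->.
by rewrite lexpos_sign // (generic_coord (simplices_basis JS) gu jJ).
Unshelve. all: by end_near. Qed.

Lemma coord_cone J X : J \in S -> (forall j, j \in J -> 0 <= bc X J j) -> in_cone G X.
Proof.
move=> /simplices_basis bJ H; exists (X *m coord G J); last exact: is_basisM.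
move=> j; have [/H//|jJ] := boolP (j \in J).
by rewrite mxE big1 // => k _; rewrite coord_off ?mulr0.
Qed.

Lemma cell_unique o J J' X : J \in S -> J' \in S -> cell o J X -> cell o J' X -> J = J'.
Proof.
move=> JS JS' cJ cJ'; near (0 : R)^'+ => e.
apply: (simplices_unique (X := X + e *: ((-1) ^+ o *: u)) JS JS').
  apply/forall_inP; rewrite (_ : [forall (j | _), _] = cell o J X) //.
  by near: e; exact: near_cell.
apply/forall_inP; rewrite (_ : [forall (j | _), _] = cell o J' X) //.
by near: e; exact: near_cell.
Unshelve. all: by end_near. Qed.

(** Along the ray each annihilator form is affine with nonzero slope, because [u] is generic, so it
    vanishes at most once. *)
Lemma near_generic o X :
  \forall e \near (0 : R)^'+, generic G (X + e *: ((-1) ^+ o *: u)).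
Proof.
rewrite /generic; apply: filter_forall => J.
have [?|nf] := boolP (row_full (maskmx G J)); first exact: nearW.
near=> e => _; rewrite mulDZmx_ij.
near: e; apply: near_neq0; rewrite -scalemxAl [X in X != _]mxE mulf_eq0 signr_eq0 /=.
exact: gu.
Unshelve. all: by end_near. Qed.

Lemma near_cone_cell o X :
  (\forall e \near (0 : R)^'+, in_cone G (X + e *: ((-1) ^+ o *: u))) ->
  exists2 J, J \in S & cell o J X.
Proof.
move=> nearX; near (0 : R)^'+ => e.
have [||J JS HJ] := @simplices_exist _ _ _ _ _ Gh _ gw (X + e *: ((-1) ^+ o *: u)).
- by near: e; exact: near_generic.
- by near: e.
exists J => //; suff <- : [forall (j | j \in J), 0 < bc (X + e *: ((-1) ^+ o *: u)) J j]
    = cell o J X by apply/forall_inP.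
have : forall J, J \in S -> [forall (j | j \in J), 0 < bc (X + e *: ((-1) ^+ o *: u)) J j]
    = cell o J X; last exact.
near: e; apply: filter_forall => J'; have [JS'|JS'] := boolP (J' \in S).
  by have := near_cell o X JS'; apply: filterS.
by apply: nearW.
Unshelve. all: by end_near. Qed.

Lemma in_coneD X Y : in_cone G X -> in_cone G Y -> in_cone G (X + Y).
Proof.
move=> [l l0 <-] [l' l'0 <-]; exists (l + l'); last by rewrite mulmxDl.
by move=> i; rewrite mxE addr_ge0.
Qed.

Lemma in_coneZ a X : 0 <= a -> in_cone G X -> in_cone G (a *: X).
Proof.
move=> a0 [l l0 <-]; exists (a *: l); last by rewrite scalemxAl.
by move=> i; rewrite mxE mulr_ge0.
Qed.

Lemma cone_cells X : in_cone G X <-> exists2 J, J \in S & cell false J X.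
Proof.
split=> [cX|[J JS /forall_inP cJ]]; last first.
  by apply: (coord_cone JS) => j /cJ /lteifW.
apply: near_cone_cell; near=> e; rewrite expr0 scale1r.
apply: in_coneD => //; apply: in_coneZ; last exact: interior_cone.
by apply/ltW; near: e; exact: nbhs_right_gt.
Unshelve. all: by end_near. Qed.

(** An interior point stays in the cone when moved slightly along [- u]. Conversely, if [X - e *: u]
    is in the cone, every facet form is nonnegative there and strictly increases on the way back to
    [X]. *)
Lemma interior_cells X : in_interior X <-> exists2 J, J \in S & cell true J X.
Proof.
split=> [iX|[J JS cJ] f ffs].
  apply: near_cone_cell.
  have [e e0 He] := perturb_pos ((-1) ^+ true *: u) iX.
  near=> e'; apply: interior_cone; apply: He; apply/andP; split.
    by near: e'; exact: nbhs_right_gt.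
  by near: e'; exact: nbhs_right_le.
near (0 : R)^'+ => e; have e0 : 0 < e by near: e; exact: nbhs_right_gt.
have : [forall (j | j \in J), 0 < bc (X + e *: ((-1) ^+ true *: u)) J j] = cell true J X.
  by near: e; exact: near_cell.
rewrite cJ => /forall_inP H.
have /cone_ge0/(_ f ffs) : in_cone G (X + e *: ((-1) ^+ true *: u)).
  by apply: (coord_cone JS) => j jJ; apply/ltW/H.
rewrite mulDZmx_ij expr1 scaleN1r mulNmx [X in e * X]mxE mulrN subr_ge0.
by apply: lt_le_trans; rewrite mulr_gt0 // iu.
Unshelve. all: by end_near. Qed.

(** The tangent cone of a cell at [M], as a condition on the direction [Y]. *)
Definition lexcell o J M Y :=
  [forall (j | j \in J), lexpos ((0 < bc u J j) (+) o) (bc M J j) (bc Y J j)].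

Lemma near_lexcell o M Y : \forall e \near (0 : R)^'+, forall J : {set 'I_n},
  cell o J (M + e *: Y) = lexcell o J M Y.
Proof.
apply: filter_forall => J.
suff : \forall e \near (0 : R)^'+, forall j,
    (0 < bc (M + e *: Y) J j ?<= if (0 < bc u J j) (+) o) =
    lexpos ((0 < bc u J j) (+) o) (bc M J j) (bc Y J j).
  by apply: filterS => e H; apply: eq_forallb => j; rewrite H.
apply: filter_forall => j; near=> e; rewrite mulDZmx_ij.
by near: e; exact: near_lexpos.
Unshelve. all: by end_near. Qed.

Lemma lexcell_unique o J J' M Y : J \in S -> J' \in S ->
  lexcell o J M Y -> lexcell o J' M Y -> J = J'.
Proof.
move=> JS JS'; near (0 : R)^'+ => e.
have E : forall J, cell o J (M + e *: Y) = lexcell o J M Y.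
  by near: e; exact: near_lexcell.
by rewrite -!E; exact: cell_unique.
Unshelve. all: by end_near. Qed.

Lemma near_lexcells o (C : set 'rV[R]_m) M Y :
  (forall X, C X <-> exists2 J, J \in S & cell o J X) ->
  (\forall e \near (0 : R)^'+, C (M + e *: Y)) <-> exists2 J, J \in S & lexcell o J M Y.
Proof.
move=> CE; split=> [nC|[J JS HJ]].
  near (0 : R)^'+ => e.
  have E : forall J, cell o J (M + e *: Y) = lexcell o J M Y.
    by near: e; exact: near_lexcell.
  have /CE[J JS cJ] : C (M + e *: Y) by near: e.
  by exists J => //; rewrite -E.
have := near_lexcell o M Y; apply: filterS => e /(_ J) E.
by apply/CE; exists J => //; rewrite E.
Unshelve. all: by end_near. Qed.

End HalfOpenCells.

(** * Valuations on cones *)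

Lemma big_subsets_setD1 (T : finType) (A : zmodType) (Z : {set T}) (j : T)
    (F : {set T} -> A) : j \in Z ->
  \sum_(Y : {set T} | Y \subset Z) F Y =
  \sum_(Y : {set T} | Y \subset Z :\ j) F Y + \sum_(Y : {set T} | Y \subset Z :\ j) F (j |: Y).
Proof.
move=> jZ; rewrite (bigID (fun Y : {set T} => j \notin Y)) /=; congr (_ + _).
  by apply: eq_bigl => Y; rewrite finset.subsetD1.
rewrite (reindex_onto (fun Y => j |: Y) (fun Y => Y :\ j)) /= => [|Y /andP[_]]; last first.
  by rewrite negbK => jY; rewrite finset.setD1K.
apply: eq_bigl => Y; rewrite finset.subsetD1 finset.subUset finset.sub1set jZ setU11 /= andbT.
apply: andb_id2l => _; apply/eqP/idP => [<-|jY]; first by rewrite setD11.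
by rewrite setU1K.
Qed.

Section ConeValuation.
Variables (R : realType) (d : nat) (A : zmodType) (v : set 'rV[R]_d -> A).
Hypotheses (vv : valuation (@cone_lattice R d) v) (v0 : v set0 = 0).
Local Notation E := 'rV[R]_d.

(* For [d = 0] the empty set is not a cone. *)
Definition cone_lattice0 (X : set E) := cone_lattice X \/ X = set0.

Lemma cone_lattice_set_lattice : set_lattice (@cone_lattice R d).
Proof.
move=> X Y LX LY; split=> L [/= Ll Lc]; have [] := Ll X Y _ _ => //;
  by [apply: LX | apply: LY].
Qed.

Lemma cone_lattice0_set_lattice : set_lattice cone_lattice0.
Proof.
move=> X Y [LX|->] [LY|->]; rewrite ?set0I ?setI0 ?set0U ?setU0; try by split; [right|left].
  by have [? ?] := cone_lattice_set_lattice LX LY; split; left.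
by split; right.
Qed.

Lemma cone_lattice0I X Y : cone_lattice0 X -> cone_lattice0 Y -> cone_lattice0 (X `&` Y).
Proof. by move=> LX /(cone_lattice0_set_lattice LX)[]. Qed.

Lemma valuation0 : valuation cone_lattice0 v.
Proof.
move=> X Y [LX|->] [LY|->]; rewrite ?set0I ?setI0 ?set0U ?setU0 ?v0 ?subr0 ?addr0 ?add0r //.
exact: vv.
Qed.

Lemma cone_lattice0T : cone_lattice0 [set: E].
Proof.
left; apply: (@sub_gen_smallest _ _ (@cone R d)).
by exists fset0 => //; rewrite set_fset0 bigcap_set0.
Qed.

Lemma dot0l x : dot (0 : E) x = 0.
Proof. by rewrite /dot big1 // => i _; rewrite mxE mul0r. Qed.

Lemma dotNl (a x : E) : dot (- a) x = - dot a x.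
Proof. by rewrite /dot -sumrN; apply: eq_bigr => i _; rewrite mxE mulNr. Qed.

(** The case [a = 0] does occur: [coord_form J j] vanishes for [j] outside [J]. The set is then
    everything or empty. *)
Lemma cone_lattice0_half s (a : E) : cone_lattice0 [set y | 0 < dot a y ?<= if s].
Proof.
have [->|a0] := eqVneq a 0.
  case: s; [rewrite (_ : [set _ | _] = setT) | rewrite (_ : [set _ | _] = set0)].
  - exact: cone_lattice0T.
  - by rewrite predeqE => y; rewrite /= dot0l.
  - by right.
  - by rewrite predeqE => y; rewrite /= dot0l ltxx.
left; apply: (@sub_gen_smallest _ _ (@cone R d)).
exists [fset halfspace (~~ s) (- a) 0]%fset => /=.
  by move=> H; rewrite in_fset1 => /eqP->; apply/mem_set; exists (~~ s), (- a); rewrite oppr_eq0.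
rewrite set_fset1 bigcap_set1; rewrite predeqE => y.
by rewrite /halfspace /= dotNl negbK; case: s; rewrite /= ?oppr_le0 ?oppr_lt0.
Qed.

Lemma cone_lattice0_halfC s (a : E) : cone_lattice0 (~` [set y | 0 < dot a y ?<= if s]).
Proof.
have := cone_lattice0_half (~~ s) (- a); congr cone_lattice0; rewrite predeqE => y /=.
rewrite dotNl; split; last by move/negP; rewrite -lteifNE; case: s; rewrite /= ?oppr_gt0 ?oppr_ge0.
by move=> H; apply/negP; rewrite -lteifNE; case: s H; rewrite /= ?oppr_gt0 ?oppr_ge0.
Qed.

Lemma valuation_disjoint_seq (T : eqType) (F : T -> set E) (s : seq T) : uniq s ->
  (forall i, i \in s -> cone_lattice0 (F i)) ->
  (forall i j y, i \in s -> j \in s -> F i y -> F j y -> i = j) ->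
  let U := [set y | exists2 i, i \in s & F i y] in
  cone_lattice0 U /\ v U = \sum_(i <- s) v (F i).
Proof.
elim: s => [_ _ _|i s IH /= /andP[is_ us] LF dF].
  rewrite /= big_nil (_ : [set _ | _] = set0) //; first by split; [right|].
  by rewrite predeqE => y; split=> // -[].
have [||LU vU] := IH us.
- by move=> j js; apply: LF; rewrite inE js orbT.
- by move=> j k y js ks; apply: dF; rewrite inE ?js ?ks orbT.
have LFi : cone_lattice0 (F i) by apply: LF; rewrite inE eqxx.
rewrite big_cons -vU.
set U := [set y | exists2 j, j \in s & F j y] in LU vU *.
rewrite (_ : [set y | _] = F i `|` U).
  split; first by have [] := cone_lattice0_set_lattice LFi LU.
  rewrite valuation0 // (_ : _ `&` _ = set0) ?v0 ?subr0 // predeqE => y; split=> //.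
  move=> [Fi [j js Fj]]; move: is_; rewrite (_ : i = j) ?js //.
  by apply: (dF i j y) => //; rewrite inE ?eqxx // js orbT.
rewrite predeqE => y; split=> [[j]|[Fi|[j js Fj]]].
- by rewrite inE => /orP[/eqP->|js Fj]; [left | right; exists j].
- by exists i => //; rewrite inE eqxx.
- by exists j => //; rewrite inE js orbT.
Qed.

Lemma valuation_disjoint (T : finType) (S : {set T}) (F : T -> set E) :
  (forall i, i \in S -> cone_lattice0 (F i)) ->
  (forall i j y, i \in S -> j \in S -> F i y -> F j y -> i = j) ->
  v [set y | exists2 i, i \in S & F i y] = \sum_(i in S) v (F i).
Proof.
move=> LF dF; rewrite -big_enum /=.
have [||_ <-] := @valuation_disjoint_seq _ F (enum S) (enum_uniq S).
- by move=> i; rewrite mem_enum; exact: LF.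
- by move=> i j y; rewrite !mem_enum; exact: dF.
congr v; rewrite predeqE => y; split=> -[i iS Fi]; exists i => //; first by rewrite mem_enum.
by rewrite -mem_enum.
Qed.

Definition meet (T : finType) (Z : {set T}) (F : T -> set E) : set E :=
  [set y | forall j, j \in Z -> F j y].

Lemma meet0 (T : finType) (F : T -> set E) : meet finset.set0 F = setT.
Proof. by rewrite predeqE => y; split=> // _ j; rewrite inE. Qed.

Lemma meetU1 (T : finType) (Z : {set T}) j (F : T -> set E) :
  meet (j |: Z) F = F j `&` meet Z F.
Proof.
rewrite predeqE => y; split=> [H|[Fj H] i].
  by split=> [|i iZ]; apply: H; rewrite !inE ?eqxx // iZ orbT.
by rewrite !inE => /orP[/eqP->//|]; apply: H.
Qed.

Lemma cone_lattice0_meet (T : finType) (Z : {set T}) (F : T -> set E) :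
  (forall j, cone_lattice0 (F j)) -> cone_lattice0 (meet Z F).
Proof.
move=> LF; have [k] := ubnP #|Z|; elim: k Z => // k IH Z Zk.
have [->|/set0Pn[j jZ]] := eqVneq Z finset.set0; first by rewrite meet0; exact: cone_lattice0T.
rewrite -(finset.setD1K jZ) meetU1; apply: cone_lattice0I => //; apply: IH.
by rewrite -ltnS (leq_trans _ Zk) // [in leqRHS](cardsD1 j) jZ.
Qed.

(** On indicators this is the expansion of the product over [Z] of one minus the indicator of the
    complement of [F j]. *)
Lemma valuation_meet_compl (T : finType) (Z : {set T}) (F : T -> set E) :
  (forall j, cone_lattice0 (F j)) -> (forall j, cone_lattice0 (~` F j)) ->
  v (meet Z F) =
  \sum_(Y : {set T} | Y \subset Z) v (meet Y (fun j => ~` F j)) *~ (-1) ^+ #|Y|.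
Proof.
move=> LF LFC; rewrite -[meet Z F]setTI.
under eq_bigr do rewrite -[meet _ _]setTI.
(* An ambient set [B] is carried along because removing [j] from [Z] intersects [B] with [F j]. *)
have := cone_lattice0T; move: [set: E] => B.
have [k] := ubnP #|Z|; elim: k Z B => // k IH Z B Zk LB.
have [->|/set0Pn[j jZ]] := eqVneq Z finset.set0.
  rewrite meet0 (big_pred1 finset.set0) => [|Y]; last by rewrite finset.subset0.
  by rewrite meet0 cards0 expr0.
have Dk : (#|Z :\ j| < k)%N.
  by rewrite -ltnS (leq_trans _ Zk) // [in leqRHS](cardsD1 j) jZ.
rewrite (big_subsets_setD1 _ jZ) -[in LHS](finset.setD1K jZ) meetU1 setIA.
rewrite IH //; last exact: cone_lattice0I.
rewrite -big_split /=; apply: eq_bigr => Y; rewrite finset.subsetD1 => /andP[_ jY].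
rewrite meetU1 cardsU1 jY exprS mulN1r mulrNz -mulrzBl; congr (_ *~ _).
set C := meet Y _; have LC : cone_lattice0 C by apply: cone_lattice0_meet.
have E1 : B `&` C = (B `&` F j `&` C) `|` (B `&` (~` F j `&` C)).
  by rewrite setIA -setIUl -setIUr setUv setIT.
rewrite E1 valuation0; try by do ?apply: cone_lattice0I.
rewrite (_ : (B `&` F j `&` C) `&` (B `&` (~` F j `&` C)) = set0) ?v0 ?subr0 ?addrK //.
by rewrite predeqE => y; split=> // -[[[_ ?] _] [_ [? _]]].
Qed.

End ConeValuation.

(** * Counting polynomials *)

(* The number of ways to write [s] as a sum of [a] nonnegative multiples of [D]. *)
Definition multiples_count (D a : nat) (s : int) : nat :=
  if (0 <= s) && (D %| s)%Z then 'C((`|(s %/ D)%Z| + a).-1, `|(s %/ D)%Z|)%N else 0%N.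

Lemma multiples_count_neg D a (s : int) : s < 0 -> multiples_count D a s = 0%N.
Proof. by rewrite /multiples_count ltNge => /negPf->. Qed.

Lemma multiples_count_ndvd (D a : nat) (s : int) : ~~ (D %| s)%Z -> multiples_count D a s = 0%N.
Proof. by rewrite /multiples_count andbC => /negPf->. Qed.

Lemma multiples_countM (D a r : nat) : (0 < D)%N ->
  multiples_count D a (r%:Z * D%:Z) = 'C((r + a).-1, r).
Proof.
move=> D0; rewrite /multiples_count dvdz_mull // andbT mulr_ge0 //.
by rewrite mulzK // -lt0n.
Qed.

(** With no summands only 0 is representable; the truncated predecessor makes the binomial
    ['C(0, 0)] there. *)
Lemma multiples_count0 (D : nat) (s : int) : (0 < D)%N -> multiples_count D 0 s = (s == 0).
Proof.
move=> D0; have [s0|s0] := ltP s 0; first by rewrite multiples_count_neg // lt_eqF.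
have [/dvdzP[q sq]|nd] := boolP (D %| s)%Z; last first.
  by rewrite multiples_count_ndvd //; case: eqP nd => // ->; rewrite dvdz0.
have q0 : 0 <= q by move: s0; rewrite sq pmulr_lge0.
case: q q0 sq => // r _ ->; rewrite multiples_countM // addn0 mulf_eq0 orbC.
by rewrite eqz_nat -[D == 0%N]negbK -lt0n D0; case: r => // r; rewrite bin_small.
Qed.

(** Pascal's rule: a chosen summand is either 0 or can be lowered by [D]. *)
Lemma multiples_countS (D a : nat) (s : int) : (0 < D)%N ->
  multiples_count D a.+1 s = (multiples_count D a.+1 (s - D%:Z) + multiples_count D a s)%N.
Proof.
move=> D0; have [s0|s0] := ltP s 0.
  by rewrite !multiples_count_neg // ?subr_lt0 // (lt_le_trans s0).
have [/dvdzP[q sq]|nd] := boolP (D %| s)%Z; last first.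
  by rewrite !multiples_count_ndvd //; apply: contra nd => H; rewrite -[s](subrK D%:Z) rpredD.
have q0 : 0 <= q by move: s0; rewrite sq pmulr_lge0.
case: q q0 sq => // -[|r] _ ->.
  rewrite [multiples_count _ _ (_ - _)]multiples_count_neg; last by rewrite mul0r sub0r oppr_lt0.
  by rewrite !multiples_countM // !bin0.
have -> : r.+1%:Z * D%:Z - D%:Z = r%:Z * D%:Z by rewrite -addn1 PoszD mulrDl mul1r addrK.
by rewrite !multiples_countM // !addSn !addnS /= binS addnC.
Qed.

(* The polynomial with value ['C(x + k, k)] at [x]. *)
Definition binomial_poly (k : nat) : {poly rat} :=
  (k`!%:R)^-1 *: \prod_(i < k) ('X + (i.+1)%:R%:P).

Lemma size_binomial_poly k : size (binomial_poly k) = k.+1.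
Proof.
rewrite size_scale ?invr_eq0 ?pnatr_eq0 -?lt0n ?fact_gt0 //.
rewrite (eq_bigr (fun i : 'I_k => 'X - (- (i.+1)%:R)%:P)) => [|i _].
  by rewrite size_prod_XsubC /index_enum -enumT size_enum_ord.
by rewrite polyCN opprK.
Qed.

Lemma lead_coef_binomial_poly k : (binomial_poly k)`_k = (k`!%:R)^-1.
Proof.
have := lead_coefZ ((k`!%:R)^-1 : rat) (\prod_(i < k) ('X + (i.+1)%:R%:P)).
rewrite -/(binomial_poly k) lead_coefE size_binomial_poly /= => ->.
rewrite (eq_bigr (fun i : 'I_k => 'X - (- (i.+1)%:R)%:P)) => [|i _].
  by rewrite lead_coef_prod big1 ?mulr1 // => i _; rewrite lead_coefXsubC.
by rewrite polyCN opprK.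
Qed.

Lemma horner_binomial_poly k (x : rat) :
  (binomial_poly k).[x] = (k`!%:R)^-1 * \prod_(i < k) (x + (i.+1)%:R).
Proof. by rewrite hornerZ horner_prod; congr (_ * _); apply: eq_bigr => i _; rewrite !hornerE. Qed.

Lemma binomial_poly_nat k (r : nat) : (binomial_poly k).[r%:R] = 'C(r + k, k)%:R.
Proof.
rewrite horner_binomial_poly.
suff -> : \prod_(i < k) (r%:R + (i.+1)%:R) = ('C(r + k, k) * k`!)%N%:R :> rat.
  by rewrite natrM mulrC mulfK // pnatr_eq0 -lt0n fact_gt0.
rewrite bin_ffact; elim: k => [|k IH]; first by rewrite big_ord0.
by rewrite big_ord_recr /= IH addnS ffactSS mulnC natrM -natrD addnS.
Qed.

Lemma binomial_poly_neg k (r : nat) : (0 < r <= k)%N -> (binomial_poly k).[- r%:R] = 0.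
Proof.
case: r => // r rk; rewrite horner_binomial_poly (bigD1 (Ordinal rk)) //=.
by rewrite addNr mul0r mulr0.
Qed.

(** The map $x \mapsto -x-(k+1)$ permutes the roots $-1,\dots,-k$, and each of the $k$ factors
    changes sign. *)
Lemma binomial_poly_sym k (x : rat) :
  (binomial_poly k).[- x - (k.+1)%:R] = (-1) ^+ k * (binomial_poly k).[x].
Proof.
rewrite !horner_binomial_poly mulrCA; congr (_ * _).
rewrite [in RHS](reindex_inj rev_ord_inj) /= -[in (-1) ^+ k](card_ord k) -prodrN.
apply: eq_bigr => i _; rewrite subnSK // natrB ?(ltnW (ltn_ord i)) //.
by rewrite -!natr1; ring.
Qed.

(** A negative $s = Dq$ in this range has $-k \le q \le -1$, a root of the polynomial, while the
    count is 0. The range is what remains after subtracting a box height, at most $D(k+1)$, from a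
    positive [t]. *)
Lemma multiples_count_poly (D k : nat) (s : int) : (0 < D)%N -> - (D * k.+1)%:Z < s ->
  (multiples_count D k.+1 s)%:R =
  if (D%:Z %| s)%Z then (binomial_poly k).[s%:~R / D%:R] else 0.
Proof.
move=> D0 s_gt; have [/dvdzP[q sq]|nd] := boolP (D%:Z %| s)%Z; last first.
  by rewrite multiples_count_ndvd.
have -> : s%:~R / D%:R = q%:~R :> rat.
  by rewrite sq intrM mulfK // pnatr_eq0 -lt0n.
case: q sq s_gt => [r|r] ->; first last.
  rewrite NegzE => s_gt; rewrite multiples_count_neg; last by nia.
  by rewrite mulrNz binomial_poly_neg //; nia.
by rewrite multiples_countM // addnS binomial_poly_nat -(bin_sub (leq_addl r k)) addnK.
Qed.

(* With [c h] the number of lattice points of height [h] in the fundamental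
   parallelepiped of a simplicial cone whose [k + 1] generators have height [D],
   the value at [t] is the number of lattice points of height [t] in the cone. *)
Definition count_poly (D k H : nat) (c : nat -> nat) (t : int) : {poly rat} :=
  \sum_(h < H.+1 | (D%:Z %| t - h%:Z)%Z)
    (c h)%:R *: (binomial_poly k \Po (D%:R^-1 *: ('X - h%:R%:P))).

Section CountPoly.
Variables (D k H : nat) (c : nat -> nat).
Hypothesis D0 : (0 < D)%N.
Local Notation p := (count_poly D k H c).

Lemma count_poly_periodic t : p (t + D%:Z) = p t.
Proof.
apply: eq_bigl => h; rewrite addrAC; apply/idP/idP => E; last by rewrite rpredD.
by rewrite -[t - _](addrK D%:Z) rpredB.
Qed.

Lemma size_affine_poly (h : nat) : size (D%:R^-1 *: ('X - (h%:R : rat)%:P)) = 2.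
Proof. by rewrite size_scale ?size_XsubC // invr_eq0 pnatr_eq0 -lt0n. Qed.

Lemma size_comp_binomial_poly (h : nat) :
  size (binomial_poly k \Po (D%:R^-1 *: ('X - (h%:R : rat)%:P))) = k.+1.
Proof. by rewrite size_comp_poly2 ?size_binomial_poly ?size_affine_poly. Qed.

Lemma size_count_poly t : (size (p t) <= k.+1)%N.
Proof.
apply: (leq_trans (size_sum _ _ _)); apply/bigmax_leqP => h _.
by apply: leq_trans (size_scale_leq _ _) _; rewrite size_comp_binomial_poly.
Qed.

Lemma coef_count_poly t : (p t)`_k =
  \sum_(h < H.+1 | (D%:Z %| t - h%:Z)%Z) (c h)%:R / (k`!%:R * D%:R ^+ k).
Proof.
rewrite coef_sum; apply: eq_bigr => h _; rewrite coefZ; congr (_ * _).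
have := lead_coef_comp (binomial_poly k) (q := D%:R^-1 *: ('X - (h%:R : rat)%:P)).
rewrite size_affine_poly => /(_ isT).
rewrite !lead_coefE size_comp_binomial_poly size_binomial_poly size_affine_poly /= => ->.
rewrite lead_coef_binomial_poly coefZ coefB coefX coefC subr0 mulr1 invfM exprVn.
by [].
Qed.

Lemma horner_count_poly t x : (p t).[x] = \sum_(h < H.+1)
  if (D%:Z %| t - h%:Z)%Z then (c h)%:R * (binomial_poly k).[(x - h%:R) / D%:R] else 0.
Proof.
rewrite horner_sum big_mkcond; apply: eq_bigr => h _; case: ifP => // _.
by rewrite hornerZ horner_comp !hornerE mulrC.
Qed.

Hypothesis HD : H = (D * k.+1)%N.

Lemma count_poly_closed (t : nat) : (0 < t)%N ->
  (\sum_(h < H.+1) c h * multiples_count D k.+1 (t%:Z - h%:Z))%N%:R = (p t%:Z).[t%:R].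
Proof.
move=> t0; rewrite horner_count_poly natr_sum; apply: eq_bigr => h _.
rewrite natrM multiples_count_poly //; last by have := ltn_ord h; lia.
by case: ifP => _; rewrite ?mulr0 // intrB.
Qed.

(** Put $x = (-t-h)/D$. Since $H = D(k+1)$, replacing $h$ by $H-h$ turns $(t-h)/D$ into $-x-(k+1)$,
    and [binomial_poly_sym] applies. *)
Lemma count_poly_open (t : nat) : (0 < t)%N ->
  (\sum_(h < H.+1) c (H - h) * multiples_count D k.+1 (t%:Z - h%:Z))%N%:R =
  (-1) ^+ k * (p (- t%:Z)).[- t%:R].
Proof.
move=> t0; rewrite horner_count_poly natr_sum mulr_sumr (reindex_inj rev_ord_inj) /=.
apply: eq_bigr => h _; have hH : (h <= H)%N by rewrite -ltnS.
rewrite !subSS subKn // natrM; move: (nat_of_ord h) hH => {}h hH.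
rewrite multiples_count_poly //; last by lia.
have -> : (D%:Z %| t%:Z - (H - h)%N%:Z)%Z = (D%:Z %| - t%:Z - h%:Z)%Z.
  have -> : t%:Z - (H - h)%N%:Z = - (- t%:Z - h%:Z + k.+1%:Z * D%:Z) by lia.
  by rewrite rpredN rpredDr // dvdz_mull.
case: ifP => _; rewrite ?mulr0 //; rewrite [RHS]mulrCA -binomial_poly_sym.
congr (_ * _.[_]); rewrite -subzn // !intrB HD PoszM intrM.
field; by rewrite pnatr_eq0 -lt0n.
Qed.

End CountPoly.

(** * Lattice points in simplicial cones *)

Definition ncard (T : choiceType) (S : set T) : nat := #|` fset_set S|.

Lemma ncardU (T : choiceType) (S1 S2 : set T) : finite_set S1 -> finite_set S2 ->
  (forall x, S1 x -> ~ S2 x) -> ncard (S1 `|` S2) = (ncard S1 + ncard S2)%N.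
Proof.
move=> f1 f2 S12; rewrite /ncard fset_setU // cardfsU (_ : _ `&` _ = fset0)%fset ?cardfs0 ?subn0 //.
by apply/fsetP => x; rewrite !inE !in_fset_set //; apply/negP => /andP[/set_mem H1 /set_mem/S12].
Qed.

Lemma ncard_image (T T' : choiceType) (f : T -> T') (S : set T) : finite_set S ->
  injective f -> ncard [set f x | x in S] = ncard S.
Proof. by move=> fS fI; rewrite /ncard fset_set_image // card_imfset. Qed.

Lemma ncard_set0 (T : choiceType) : ncard (set0 : set T) = 0%N.
Proof. by rewrite /ncard fset_set0 cardfs0. Qed.

Lemma ncard_gt0 (T : choiceType) (S : set T) x : finite_set S -> S x -> (0 < ncard S)%N.
Proof.
by move=> fS Sx; rewrite cardfs_gt0; apply/fset0Pn; exists x; rewrite in_fset_set // inE.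
Qed.

Lemma finite_int_box d (N : nat) :
  finite_set [set m : 'rV[int]_d | forall i, `|m 0 i| <= N%:Z].
Proof.
pose f (g : {ffun 'I_d -> 'I_(2 * N).+1}) : 'rV[int]_d := \row_i ((g i : nat)%:Z - N%:Z).
apply: (@sub_finite_set _ _ [set f g | g in [set: {ffun 'I_d -> 'I_(2 * N).+1}]]).
  move=> m /= Hm; exists [ffun i : 'I_d => inord (absz (m 0 i + N%:Z))] => //.
  apply/matrixP => i j; rewrite ord1 !mxE ffunE inordK; by have := Hm j; lia.
by apply: finite_image; exact: finite_finset.
Qed.

Lemma lteif_addr (R : realFieldType) s (b c : R) : 0 < c ->
  (0 < b ?<= if s) -> (0 < b + c ?<= if s).
Proof. by case: s => /=; lra. Qed.

Section LatticeCount.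
Variables (R : realType) (d n : nat) (pt : 'I_n -> 'rV[R]_d) (z : 'I_n -> 'rV[int]_d).
Variable D : nat.
Hypotheses (D0 : (0 < D)%N) (Hz : forall i, intv R (z i) = D%:R *: pt i).

Definition hom (x : 'rV[R]_d) (t : R) : 'rV[R]_(d + 1) := row_mx x t%:M.
Definition hommx : 'M[R]_(n, d + 1) := row_mx (\matrix_i pt i) (const_mx 1).
Definition height : 'cV[R]_(d + 1) := col_mx 0 1%:M.

Lemma homD x y s t : hom (x + y) (s + t) = hom x s + hom y t.
Proof. by rewrite /hom add_row_mx raddfD. Qed.

Lemma homZ a x t : hom (a *: x) (a * t) = a *: hom x t.
Proof. by rewrite /hom scale_row_mx scale_scalar_mx. Qed.

Lemma hom_height x t : hom x t *m height = t%:M.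
Proof. by rewrite mul_row_col mulmx0 add0r mulmx1. Qed.

Lemma hommx_height : hommx *m height = const_mx 1.
Proof. by rewrite mul_row_col mulmx0 add0r mulmx1. Qed.

Lemma row_hommx i : row i hommx = hom (pt i) 1.
Proof.
rewrite row_row_mx rowK; congr row_mx; apply/matrixP => a b.
by rewrite !ord1 !mxE.
Qed.

Lemma mul_hommx (l : 'rV[R]_n) x t :
  l *m hommx = hom x t <-> \sum_i l 0 i *: pt i = x /\ \sum_i l 0 i = t.
Proof.
have -> : l *m hommx = hom (\sum_i l 0 i *: pt i) (\sum_i l 0 i).
  rewrite mul_mx_row; congr row_mx; first by rewrite mulmx_sum_row; under eq_bigr do rewrite rowK.
  apply/matrixP => a b; rewrite !ord1 !mxE mulr1n; apply: eq_bigr => i _.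
  by rewrite mxE mulr1.
split=> [/eq_row_mx[<- /matrixP/(_ 0 0)]|[-> -> //]].
by rewrite !mxE !mulr1n.
Qed.

Variable J : {set 'I_n}.
Hypothesis bJ : is_basis hommx J (coord hommx J).

(** Unnormalised barycentric coordinates: they sum to [t], not to 1. *)
Definition bary (m : 'rV[int]_d) (t : int) : 'rV[R]_n :=
  hom (intv R m) t%:~R *m coord hommx J.

Lemma intvD (m m' : 'rV[int]_d) : intv R (m + m') = intv R m + intv R m'.
Proof. exact: map_mxD. Qed.

Lemma intvN (m : 'rV[int]_d) : intv R (- m) = - intv R m.
Proof. exact: map_mxN. Qed.

Lemma baryD m m' t t' : bary (m + m') (t + t') = bary m t + bary m' t'.
Proof. by rewrite /bary intvD intrD homD mulmxDl. Qed.

Lemma bary0 : bary 0 0 = 0.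
Proof. by rewrite /bary /hom mulr0z raddf0 /intv map_mx0 row_mx0 mul0mx. Qed.

Lemma baryN m t : bary (- m) (- t) = - bary m t.
Proof. by apply/eqP; rewrite -addr_eq0 -baryD !addNr bary0. Qed.

Lemma baryN_ij m t i j : bary (- m) (- t) i j = - bary m t i j.
Proof. by rewrite baryN [LHS]mxE. Qed.

Lemma bary_vertex i j : i \in J -> bary (z i) D%:Z 0 j = D%:R * (i == j)%:R.
Proof.
move=> iJ; have [_ _ GC] := bJ.
rewrite /bary Hz -[D%:~R]mulr1 homZ -row_hommx -scalemxAl mxE; congr (_ * _).
by rewrite -row_mul mxE GC.
Qed.

Lemma bary_shift i m t j : i \in J ->
  bary (m + z i) (t + D%:Z) 0 j = bary m t 0 j + D%:R * (i == j)%:R.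
Proof. by move=> iJ; rewrite baryD mxE bary_vertex. Qed.

Lemma bary_off m t j : j \notin J -> bary m t 0 j = 0.
Proof. by move=> jJ; rewrite mxE big1 // => k _; rewrite coord_off // mulr0. Qed.

Lemma bary_combination m t :
  \sum_i bary m t 0 i *: pt i = intv R m /\ \sum_i bary m t 0 i = t%:~R.
Proof. by apply/mul_hommx; rewrite is_basisM. Qed.

Lemma finite_bary_ge0 t :
  finite_set [set m | forall j, j \in J -> 0 <= bary m t 0 j].
Proof.
pose N := Num.bound (\sum_i \sum_j `|t%:~R| * `|pt i 0 j|).
apply: sub_finite_set (finite_int_box d N) => m /= Hm i.
have [m_sum t_sum] := bary_combination m t.
have pos k : 0 <= bary m t 0 k.
  by have [/Hm//|kJ] := boolP (k \in J); rewrite bary_off.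
have le_t k : bary m t 0 k <= `|t%:~R|.
  by rewrite -t_sum (le_trans _ (ler_norm _)) // (bigD1 k) //= lerDl sumr_ge0.
rewrite -(ler_int R) intr_norm.
have -> : (m 0 i)%:~R = intv R m 0 i by rewrite mxE.
rewrite -m_sum summxE (le_trans (ler_norm_sum _ _ _)) //.
apply: le_trans (_ : \sum_i \sum_j `|t%:~R| * `|pt i 0 j| <= _); last first.
  rewrite -pmulrn; apply/ltW/archi_boundP.
  by apply: sumr_ge0 => a _; apply: sumr_ge0 => b _; rewrite mulr_ge0.
apply: ler_sum => a _; rewrite mxE normrM (bigD1 i) //= ler_wpDr ?sumr_ge0 //.
by rewrite ler_wpM2r // ger0_norm.
Qed.

(* [o] selects positive ([true]) or nonnegative coordinates on [B]; the coordinates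
   in [B] outside [Act] are moreover confined to a fundamental interval of length [D]. *)
Definition box_points o (B Act : {set 'I_n}) (t : int) : set 'rV[int]_d :=
  [set m | forall j, j \in J -> if j \in B then
     (0 < bary m t 0 j ?<= if ~~ o) &&
     ((j \in Act) || ~~ (0 < bary m t 0 j - D%:R ?<= if ~~ o))
   else bary m t 0 j == 0].

Lemma finite_box_points o B Act t : finite_set (box_points o B Act t).
Proof.
apply: sub_finite_set (finite_bary_ge0 t) => m /= H j /H.
by case: ifP => _ => [/andP[/lteifW] | /eqP->].
Qed.

Lemma bary_ge0_lt0 m t : t < 0 -> ~ forall j, j \in J -> 0 <= bary m t 0 j.
Proof.
move=> t0 H; have [_ /esym E] := bary_combination m t.
have : (0 : R) <= t%:~R.
  by rewrite E; apply: sumr_ge0 => j _; have [/H//|jJ] := boolP (j \in J); rewrite bary_off.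
by rewrite ler0z leNgt t0.
Qed.

Lemma box_points_neg o B Act t : t < 0 -> box_points o B Act t = set0.
Proof.
move=> t0; rewrite predeqE => m; split=> // H; apply: (@bary_ge0_lt0 m t t0) => j /H.
by case: ifP => _ => [/andP[/lteifW] | /eqP->].
Qed.

(** A point whose coordinate at [j] survives lowering by [D] is the translate by [z j] of a point at
    height [t - D]; the others lie in the fundamental interval. The recursion matches
    [multiples_countS]. *)
Lemma ncard_box_pointsU1 o (B Act : {set 'I_n}) j t : j \in J -> j \in B -> j \notin Act ->
  ncard (box_points o B (j |: Act) t) =
  (ncard (box_points o B (j |: Act) (t - D%:Z)) + ncard (box_points o B Act t))%N.
Proof.
move=> jJ jB jA.
rewrite -[X in (X + _)%N](@ncard_image _ _ (fun m => m + z j)); last 2 first.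
- exact: finite_box_points.
- exact: addIr.
rewrite -ncardU; last 3 first.
- by apply: finite_image; exact: finite_box_points.
- exact: finite_box_points.
- move=> _ [m Hm <-] /(_ j jJ); rewrite jB (negPf jA) -[t](subrK D%:Z).
  rewrite bary_shift // eqxx mulr1 addrK.
  by have := Hm j jJ; rewrite jB => /andP[->] /= _; rewrite andbF.
have shift m k : bary (m - z j) (t - D%:Z) 0 k = bary m t 0 k - D%:R * (j == k)%:R.
  by rewrite -[in RHS](subrK (z j) m) -[in RHS](subrK D%:Z t) bary_shift // addrK.
congr ncard; rewrite predeqE => m; split=> [H|[[m' H <-] i iJ|H i iJ]].
- have [lt|lt] := boolP (0 < bary m t 0 j - D%:R ?<= if ~~ o).
    left; exists (m - z j); last by rewrite subrK.
    move=> i iJ; have := H i iJ; rewrite shift !inE.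
    have [<-|ij] := eqVneq j i; last by rewrite mulr0 subr0.
    by rewrite jB mulr1 lt.
  right=> i iJ; have := H i iJ; rewrite !inE.
  by have [->|//] := eqVneq i j; rewrite jB (negPf jA) lt.
- have := H i iJ; rewrite -[in bary _ t](subrK D%:Z t) bary_shift // !inE.
  have [<-|ij] := eqVneq j i; last by rewrite mulr0 addr0.
  by rewrite jB mulr1 /= !andbT; apply: lteif_addr; rewrite ltr0n.
- by have := H i iJ; rewrite !inE; case: ifP => // _ /andP[-> /orP[->|->]]; rewrite !orbT.
Qed.

(** Subtracting from the sum of the [z i] over [B] exchanges the intervals $(0,D]$ and $[0,D)$ and
    sends height [t] to $D|B|-t$. *)
Lemma box_points_sym (B : {set 'I_n}) t : B \subset J ->
  ncard (box_points true B finset.set0 t) =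
  ncard (box_points false B finset.set0 ((D * #|B|)%N%:Z - t)).
Proof.
move=> BJ; pose zB := \sum_(i in B) z i.
have zE m s k : bary (zB + m) ((D * #|B|)%N%:Z + s) 0 k = D%:R * (k \in B)%:R + bary m s 0 k.
  have -> : (D * #|B|)%N%:Z = \sum_(i in B) D%:Z.
    by rewrite sumr_const -mulr_natl natz mulrC PoszM.
  rewrite baryD mxE; congr (_ + _); rewrite /zB.
  have -> : bary (\sum_(i in B) z i) (\sum_(i in B) D%:Z) = \sum_(i in B) bary (z i) D%:Z.
    elim: (index_enum _) => [|i r IH]; first by rewrite !big_nil bary0.
    by rewrite !big_cons; case: (i \in B); rewrite // baryD IH.
  rewrite summxE (eq_bigr (fun i => D%:R * (i == k)%:R)) => [|i iB]; last first.
    by rewrite bary_vertex // (fintype.subsetP BJ).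
  rewrite -mulr_sumr; congr (_ * _); have [kB|kB] := boolP (k \in B).
    by rewrite (bigD1 k) //= eqxx big1 ?addr0 // => i /andP[_ /negPf->].
  by rewrite big1 // => i iB; case: eqP kB => // <-; rewrite iB.
rewrite -(@ncard_image _ _ (fun m => zB - m)) //; last 2 first.
- exact: finite_box_points.
- by move=> x y /addrI/oppr_inj.
have D1 : (0 : R) < D%:R by rewrite ltr0n.
congr ncard; rewrite predeqE => m; split=> [[m' H <-] j jJ|H].
  have := H j jJ; rewrite zE baryN_ij inE; case: (j \in B).
    by rewrite mulr1 /= -!leNgt -!ltNge /=; move=> /andP[? ?]; apply/andP; split; lra.
  by rewrite mulr0 sub0r oppr_eq0.
exists (zB - m); last by rewrite subKr.
move=> j jJ; rewrite -[t](subKr (D * #|B|)%N%:Z) zE baryN_ij.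
have := H j jJ; rewrite inE; case: (j \in B).
  by rewrite mulr1 /= -!leNgt -!ltNge /=; move=> /andP[? ?]; apply/andP; split; lra.
by rewrite mulr0 sub0r oppr_eq0.
Qed.

(** Each coordinate of a box point is between 0 and [D], so box heights run from 0 to $D|B|$. *)
Lemma ncard_box_points0 o (B : {set 'I_n}) (t : int) : B \subset J ->
  ncard (box_points o B finset.set0 t) =
  (\sum_(h < (D * #|B|).+1) ncard (box_points o B finset.set0 h) * (t == h%:Z))%N.
Proof.
move=> BJ; have [t0|t0] := ltP t 0.
  rewrite box_points_neg // ncard_set0 big1 // => h _.
  by case: eqP t0 => [->|_ _]; rewrite ?muln0.
have [tH|tH] := leP t (D * #|B|)%N%:Z.
  case: t t0 tH => // t _; rewrite lez_nat -ltnS => tH.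
  rewrite (bigD1 (Ordinal tH)) //= eqxx muln1 big1 ?addn0 // => h.
  by rewrite eqz_nat -val_eqE /= eq_sym => /negPf->; rewrite muln0.
rewrite big1 => [|h _]; last first.
  by have := ltn_ord h; case: eqP tH => [->|]; rewrite ?muln0 // ltz_nat ltnS ltnNge => /negPf->.
apply/eqP; rewrite -leqn0 leqNgt; apply/negP => pos.
suff H0 : box_points o B finset.set0 t = set0 by rewrite H0 ncard_set0 in pos.
rewrite predeqE => m; split=> // H; have [_ E] := bary_combination m t.
have : (t%:~R : R) <= (D * #|B|)%N%:R.
  rewrite -E natrM -sumr_const mulr_sumr [leRHS]big_mkcond /=; apply: ler_sum => j _.
  have [jJ|jJ] := boolP (j \in J); last first.
    by rewrite bary_off //; case: ifP => // _; rewrite mulr1 ler0n.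
  have := H j jJ; rewrite inE; case: ifP => [_ /andP[_]|_ /eqP->//].
  by rewrite /= mulr1; case: (o) => /=; rewrite -?leNgt -?ltNge subr_lte0 // => /ltW.
by rewrite -[(D * #|B|)%N%:R]/((D * #|B|)%N%:Z%:~R) ler_int leNgt tH.
Qed.

Lemma ncard_box_points o (B Act : {set 'I_n}) (t : int) : B \subset J -> Act \subset B ->
  ncard (box_points o B Act t) =
  (\sum_(h < (D * #|B|).+1) ncard (box_points o B finset.set0 h) *
     multiples_count D #|Act| (t - h%:Z))%N.
Proof.
move=> BJ; have [k] := ubnP #|Act|; elim: k Act t => // k IHk Act t Actk ActB.
have [->|/set0Pn[j jA]] := eqVneq Act finset.set0.
  rewrite ncard_box_points0 //; apply: eq_bigr => h _.
  by rewrite cards0 multiples_count0 // subr_eq0.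
have jB := fintype.subsetP ActB j jA; have jJ := fintype.subsetP BJ j jB.
have cA : #|Act| = #|Act :\ j|.+1 by rewrite (cardsD1 j) jA.
(* Lowering [t] by [D] calls for a second induction, on an upper bound of [t]; below 0 both sides
   vanish. *)
have [N] : exists N : nat, t < N%:Z by exists `|t|.+1; lia.
elim: N t => [|N IHN] t tN.
  rewrite box_points_neg // ncard_set0 big1 // => h _.
  by rewrite multiples_count_neg ?muln0 //; lia.
rewrite -(finset.setD1K jA) ncard_box_pointsU1 ?setD11 //.
rewrite (finset.setD1K jA) IHN; last by lia.
rewrite IHk; last 2 first.
- by rewrite -ltnS -cA.
- by apply: fintype.subset_trans ActB; exact: subD1set.
rewrite -big_split /=; apply: eq_bigr => h _; rewrite -mulnDr; congr (_ * _)%N.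
by rewrite cA [RHS]multiples_countS // addrAC.
Qed.

End LatticeCount.

(** * Polyhedra and vertices *)

Section Dot.
Variables (R : realType) (d : nat).
Implicit Types (a x y : 'rV[R]_d).

Lemma dotDZr a x y e : dot a (x + e *: y) = dot a x + e * dot a y.
Proof.
rewrite /dot mulr_sumr -big_split; apply: eq_bigr => i _ /=.
by rewrite !mxE mulrDr mulrCA.
Qed.

Lemma dot0r a : dot a 0 = 0.
Proof. by rewrite /dot big1 // => i _; rewrite mxE mulr0. Qed.

Lemma dotNr a x : dot a (- x) = - dot a x.
Proof. by rewrite -[- x]add0r -scaleN1r dotDZr dot0r add0r mulN1r. Qed.

Lemma dotZr a e x : dot a (e *: x) = e * dot a x.
Proof. by rewrite -[e *: x]add0r dotDZr dot0r add0r. Qed.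

Lemma dot_sumr a (I : finType) (l : I -> R) (x : I -> 'rV[R]_d) :
  dot a (\sum_i l i *: x i) = \sum_i l i * dot a (x i).
Proof.
elim: (index_enum _) => [|i r IH]; first by rewrite !big_nil dot0r.
by rewrite !big_cons addrC dotDZr IH addrC.
Qed.

Lemma dot_suml (I : finType) (S : pred I) (a : I -> 'rV[R]_d) x :
  dot (\sum_(i | S i) a i) x = \sum_(i | S i) dot (a i) x.
Proof.
rewrite /dot exchange_big; apply: eq_bigr => j _ /=.
by rewrite summxE mulr_suml.
Qed.

Lemma dot_self_gt0 a : a != 0 -> 0 < dot a a.
Proof.
move=> a0; have := @sqr_cV_gt0 _ _ a^T; rewrite trmx_eq0 trmxK => /(_ a0).
by rewrite mxE; congr (0 < _); apply: eq_bigr => i _; rewrite mxE.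
Qed.

Lemma continuous_dot a : continuous (dot a).
Proof.
suff H (r : seq 'I_d) : continuous (fun x : 'rV[R]_d => \sum_(i <- r) a 0 i * x 0 i).
  exact: H.
elim: r => [|i r IH].
  rewrite (_ : (fun x => _) = fun=> 0); first exact: cst_continuous.
  by apply/funext => x; rewrite big_nil.
rewrite (_ : (fun x => _) = fun x => a 0 i * x 0 i + \sum_(i <- r) a 0 i * x 0 i); last first.
  by apply/funext => x; rewrite big_cons.
move=> x; apply: (@continuousD R R _ (fun y : 'rV[R]_d => a 0 i * y 0 i)); last exact: IH.
apply: (@continuousM R _ (fun=> a 0 i) (fun y : 'rV[R]_d => y 0 i)).
  exact: cst_continuous.
exact: coord_continuous.
Qed.

End Dot.

Lemma affine_hull_nonempty (R : realType) d (P : set 'rV[R]_d) :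
  affine_hull P = setT -> P !=set0.
Proof.
move=> hullT; have [[|n] [y [l [Py l1 _]]]] : affine_hull P 0 by rewrite hullT.
  by move: l1; rewrite big_ord0 => /eqP; rewrite eq_sym oner_eq0.
by exists (y ord0).
Qed.

(** * Vertices, convex hull and interior of a closed polyhedron *)

Section ClosedPolyhedron.
Variables (R : realType) (d N : nat) (a : 'I_N -> 'rV[R]_d) (b : 'I_N -> R).
Implicit Types (x y : 'rV[R]_d) (k : 'I_N).

Definition polyhedron : set 'rV[R]_d := [set x | forall k, dot (a k) x <= b k].
Definition polyhedron_interior : set 'rV[R]_d := [set x | forall k, dot (a k) x < b k].
Definition active x : {set 'I_N} := [set k | dot (a k) x == b k].

Local Notation Q := polyhedron.

Lemma near_polyhedron x y : Q x -> (forall k, k \in active x -> dot (a k) y <= 0) ->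
  \forall e \near (0 : R)^'+, Q (x + e *: y).
Proof.
move=> Qx H; apply: filter_forall => k; near=> e.
rewrite dotDZr -subr_ge0 opprD addrA -mulrN.
have -> : (0 <= b k - dot (a k) x + e * - dot (a k) y) =
    lexpos true (b k - dot (a k) x) (- dot (a k) y) by near: e; exact: (near_lexpos true).
rewrite /lexpos /= subr_gt0 lt_neqAle Qx andbT subr_eq0 [b k == _]eq_sym.
have [E|] := eqVneq (dot (a k) x) (b k); last by [].
by rewrite oppr_ge0 H // inE E.
Unshelve. all: by end_near. Qed.

(** If [y] is orthogonal to the active normals, [x] can move both ways along [y], so the supporting
    form is constant along [y] and uniqueness forces [y = 0]. Conversely, the sum of the active
    constraints supports the polyhedron at [x] only. *)
Lemma vertexP x : vertex Q x <->
  Q x /\ forall y, (forall k, k \in active x -> dot (a k) y = 0) -> y = 0.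
Proof.
split=> [[al [be [Qle Qx]]]|[Qx ker]].
  have [Qxx /= alx] : (Q `&` [set y | dot al y = be]) x by rewrite Qx.
  split=> // y Hy; near (0 : R)^'+ => e.
  have e0 : 0 < e by near: e; exact: nbhs_right_gt.
  have Q1 : Q (x + e *: y) by near: e; apply: near_polyhedron => // k /Hy ->.
  have Q2 : Q (x + e *: - y).
    by near: e; apply: near_polyhedron => // k /Hy; rewrite dotNr => ->; rewrite oppr0.
  have aly : dot al y = 0.
    have := Qle _ Q1; have := Qle _ Q2; rewrite /= !dotDZr alx dotNr.
    by rewrite gerDl mulrN oppr_le0 gerDl pmulr_rge0 // pmulr_rle0 // => ? ?; apply/le_anti/andP.
  have : (Q `&` [set y | dot al y = be]) (x + e *: y).
    by split=> //=; rewrite dotDZr aly mulr0 addr0.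
  rewrite Qx /= => /eqP; rewrite addrC -subr_eq0 addrK scaler_eq0 gt_eqF //=.
  by move/eqP.
exists (\sum_(k in active x) a k), (\sum_(k in active x) b k); split.
  by move=> y Qy /=; rewrite dot_suml; apply: ler_sum.
rewrite predeqE => y; split=> [[Qy /=]|->]; last first.
  by split=> //=; rewrite dot_suml; apply: eq_bigr => k; rewrite inE => /eqP.
rewrite dot_suml => /eqP; rewrite eq_sym -subr_eq0 -sumrB psumr_eq0 => [/allP E|k _]; last first.
  by rewrite subr_ge0.
apply/eqP; rewrite -subr_eq0; apply/eqP/ker => k ka.
have := E k (mem_index_enum _); rewrite ka /= subr_eq0 => /eqP bk.
by rewrite -[- x]scale1r scalerN -scaleNr dotDZr -bk; move: ka; rewrite inE => /eqP->; ring.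
Unshelve. all: by end_near. Qed.

Lemma finite_vertex : finite_set (vertex Q).
Proof.
pose f (S : {set 'I_N}) := xget 0 [set x | vertex Q x /\ active x = S].
apply: (@sub_finite_set _ _ [set f S | S in [set: {set 'I_N}]]).
  move=> x vx; exists (active x) => //; rewrite /f.
  case: xgetP => [y _ [vy E]|/(_ x)[]] //; apply/eqP; rewrite -subr_eq0; apply/eqP.
  have [Qx kx] := (vertexP x).1 vx; apply: kx => k ka.
  have := ka; rewrite -E inE -[- x]scale1r scalerN -scaleNr dotDZr => /eqP->.
  by move: ka; rewrite inE => /eqP->; ring.
by apply: finite_image; exact: finite_finset.
Qed.

Lemma ray_exit x y : bounded_set Q -> Q x -> y != 0 ->
  exists2 s, 0 <= s & Q (x + s *: y) /\
    exists2 k, 0 < dot (a k) y & dot (a k) (x + s *: y) = b k.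
Proof.
move=> bQ Qx y0.
have [k0 k0P] : exists k, 0 < dot (a k) y.
  apply/not_existsP => H.
  have [M [_ MQ]] := bQ; have y1 : 0 < `|y| by rewrite normr_gt0.
  (* With this [s], the norm of [s *: y] is [M1 + |x| + 1], so [x + s *: y] violates the bound
     [M1]. *)
  pose M1 := `|M| + 1; pose s := (M1 + `|x| + 1) / `|y|.
  have M1_gt : M < M1 by rewrite (le_lt_trans (ler_norm _)) // ltrDl.
  have s0 : 0 <= s by rewrite divr_ge0 ?addr_ge0.
  have Qs : Q (x + s *: y).
    move=> k; rewrite dotDZr; apply: le_trans (Qx k); rewrite gerDl mulr_ge0_le0 //.
    by rewrite leNgt; apply/negP/H.
  have /= := MQ _ M1_gt _ Qs; rewrite leNgt => /negP; apply.
  have : `|s *: y| <= `|x + s *: y| + `|x|.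
    by rewrite -{1}[s *: y](addKr x) addrC (le_trans (ler_normD _ _)) // normrN.
  rewrite normrZ ger0_norm // /s mulfVK ?gt_eqF //; lra.
pose r k := (b k - dot (a k) x) / dot (a k) y.
have [k kP kmin] : exists2 k, 0 < dot (a k) y & forall j, 0 < dot (a j) y -> r k <= r j.
  by have [k ? ?] := @arg_minP _ _ _ k0 (fun k => 0 < dot (a k) y) r k0P; exists k.
have r0 : 0 <= r k by rewrite divr_ge0 ?subr_ge0 ?(ltW kP) //; exact: Qx.
exists (r k) => //; split; last first.
  by exists k => //; rewrite dotDZr mulfVK ?gt_eqF // addrC subrK.
move=> j; rewrite dotDZr; have [jP|jP] := ltP 0 (dot (a j) y).
  by rewrite addrC -lerBrDr -ler_pdivlMr // kmin.
by apply: le_trans (Qx j); rewrite gerDl mulr_ge0_le0.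
Qed.

(* Minkowski's theorem: moving both ways along a line orthogonal to the active
   normals exhibits a point as a convex combination of points with more active
   constraints. *)
Lemma polyhedron_hull (C : set 'rV[R]_d) : bounded_set Q -> vertex Q `<=` C ->
  (forall x y s, 0 <= s <= 1 -> C x -> C y -> C (x + s *: (y - x))) -> Q `<=` C.
Proof.
move=> bQ vC cC x; have [k] := ubnP #|~: active x|; elim: k x => // k IH x xk Qx.
have [ker|] := pselect (forall y, (forall k, k \in active x -> dot (a k) y = 0) -> y = 0).
  by apply: vC; apply/vertexP.
move=> /existsNP[y /not_implyP[ky /eqP y0]].
have fewer y' s j : (forall k, k \in active x -> dot (a k) y' = 0) ->
    0 < dot (a j) y' -> dot (a j) (x + s *: y') = b j ->
    (#|~: active (x + s *: y')| < k)%N.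
  move=> ky' jy' jb; rewrite -ltnS (leq_trans _ xk) // ltnS proper_card //; apply/properP.
  split.
    rewrite finset.setCS; apply/fintype.subsetP => i ia.
    by rewrite inE dotDZr ky' // mulr0 addr0; rewrite inE in ia.
  exists j; rewrite !inE; last by rewrite jb eqxx.
  by apply/negP => ja; have := ky' j; rewrite inE ja => /(_ isT) E; rewrite E ltxx in jy'.
have kNy i : i \in active x -> dot (a i) (- y) = 0.
  by move=> /ky; rewrite dotNr => ->; rewrite oppr0.
have [s1 s10 [Q1 [k1 k1y k1b]]] := ray_exit bQ Qx y0.
have [s2 s20 [Q2 [k2 k2y k2b]]] : exists2 s, 0 <= s & Q (x + s *: - y) /\
    exists2 k, 0 < dot (a k) (- y) & dot (a k) (x + s *: - y) = b k.
  by apply: ray_exit; rewrite ?oppr_eq0.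
have C1 := IH _ (fewer _ _ _ ky k1y k1b) Q1.
have C2 := IH _ (fewer _ _ _ kNy k2y k2b) Q2.
have s1_gt0 : 0 < s1.
  rewrite lt_neqAle s10 andbT; apply/eqP => s1E; move: k1b.
  rewrite -s1E scale0r addr0 => /eqP k1a; have := ky k1; rewrite inE => /(_ k1a) E.
  by rewrite E ltxx in k1y.
(* The parameter at which the segment from [x - s2 *: y] to [x + s1 *: y] passes through [x]. *)
have := cC _ _ (s2 / (s1 + s2)) _ C2 C1.
have s12 : 0 < s1 + s2 by rewrite ltr_wpDr.
rewrite divr_ge0 ?ler_pdivrMr ?mul1r ?lerDr ?s10 ?(ltW s12) //= => /(_ isT).
congr C; rewrite opprD addrACA subrr add0r scalerN opprK -scalerDl scalerA mulfVK ?gt_eqF //.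
by rewrite subrK.
Qed.

Hypothesis a_neq0 : forall k, a k != 0.

Lemma interior_polyhedron_near x : polyhedron_interior x -> \forall y \near x, Q y.
Proof.
move=> ix.
apply: (@filter_forall _ _ (fun k y => dot (a k) y <= b k) _ (nbhs_filter x)) => k.
have n : nbhs x (dot (a k) @^-1` [set y | y < b k]).
  by apply: continuous_dot; exact: (lt_nbhsl (ix k)).
by have := n; apply: (@filterS _ _ (nbhs_filter x)) => y /= /ltW.
Qed.

Lemma relint_polyhedron : affine_hull Q = setT -> relint Q = polyhedron_interior.
Proof.
move=> hullT; rewrite predeqE => x; split=> [[Qx nx] k|ix].
  have line : (fun e : R => x + e *: a k) @ 0^'+ --> x.
    rewrite -[X in _ --> X]addr0 -(scale0r (a k)); apply: cvgD; first exact: cvg_cst.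
    by apply: cvgZ; [exact: cvg_at_right_filter | exact: cvg_cst].
  near (0 : R)^'+ => e; have e0 : 0 < e by near: e; exact: nbhs_right_gt.
  have : affine_hull Q (x + e *: a k) -> Q (x + e *: a k).
    by near: e; exact: line nx.
  rewrite hullT => /(_ I)/(_ k); rewrite dotDZr; apply: lt_le_trans.
  by rewrite ltrDl mulr_gt0 // dot_self_gt0.
split; first by move=> k; apply/ltW/ix.
by have := interior_polyhedron_near ix; apply: (@filterS _ _ (nbhs_filter x)).
Unshelve. all: by end_near. Qed.

(** A constraint tight on the whole polyhedron would confine its affine hull to a hyperplane.
    Midpoints then collect the strict constraints one at a time. *)
Lemma interior_point : affine_hull Q = setT -> exists x, polyhedron_interior x.
Proof.
move=> hullT.
have [p Qp] := affine_hull_nonempty hullT.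
have strict k : exists2 q, Q q & dot (a k) q < b k.
  apply/not_exists2P => H.
  have E q : Q q -> dot (a k) q = b k.
    move=> Qq; apply/eqP; rewrite eq_le Qq /= leNgt; apply/negP => lt.
    by have [] := H q.
  have Eall x : dot (a k) x = b k.
    have [n [y [l [Qy l1 ->]]]] : affine_hull Q x by rewrite hullT.
    by rewrite dot_sumr -[RHS]mul1r -l1 mulr_suml; apply: eq_bigr => i _; rewrite E.
  by have := dot_self_gt0 (a_neq0 k); rewrite Eall -(Eall 0) dot0r ltxx.
suff [x [_ Hx]] : exists x, Q x /\ forall k, k \in enum 'I_N -> dot (a k) x < b k.
  by exists x => k; apply: Hx; rewrite mem_enum.
elim: (enum 'I_N) => [|k s [x [Qx IH]]]; first by exists p.
have [q Qq qk] := strict k; exists (x + 2^-1 *: (q - x)); split=> [j|j].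
  rewrite dotDZr -[- x]scale1r scalerN -scaleNr dotDZr.
  by have := Qx j; have := Qq j; lra.
rewrite -[- x]scale1r scalerN -scaleNr !dotDZr inE => /orP[/eqP->|js].
  by have := Qx k; lra.
by have := IH j js; have := Qq j; lra.
Qed.

End ClosedPolyhedron.

Section Polytope.
Variables (R : realType) (d : nat).
Implicit Types (P : set 'rV[R]_d).

Lemma finI_halfspaces P : convex_polyhedron P ->
  exists N (s : 'I_N -> bool) (a : 'I_N -> 'rV[R]_d) (b : 'I_N -> R),
    (forall k, a k != 0) /\ P = [set x | forall k, halfspace (s k) (a k) (b k) x].
Proof.
move=> [F FH <-]; pose sF : seq (set 'rV[R]_d) := F.
pose ok (H : set 'rV[R]_d) (p : bool * 'rV[R]_d * R) :=
  p.1.2 != 0 /\ H = halfspace p.1.1 p.1.2 p.2.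
have /choice[f Hf] (k : 'I_(size sF)) : exists p, ok (nth setT sF k) p.
  have /FH/set_mem[s [a [b [a0 E]]]] : nth setT sF k \in F by apply: mem_nth.
  by exists (s, a, b).
exists (size sF), (fun k => (f k).1.1), (fun k => (f k).1.2), (fun k => (f k).2).
split=> [k|]; first by case: (Hf k).
rewrite predeqE => x; split=> [Fx k|Hx H HF].
  by case: (Hf k) => _ <-; apply: Fx; apply: mem_nth.
have HFi : (index H sF < size sF)%N by rewrite index_mem.
by have := Hx (Ordinal HFi); case: (Hf (Ordinal HFi)) => _ <-; rewrite /= nth_index.
Qed.

(** Strict half-spaces may occur in the description, but relaxing them adds nothing: [x] is the
    limit of [x + e *: (p - x)], which meets the strict constraints because [p] does. *)
Lemma closed_polyhedron P : convex_polyhedron P -> closed P -> P !=set0 ->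
  exists N (a : 'I_N -> 'rV[R]_d) (b : 'I_N -> R),
    (forall k, a k != 0) /\ P = polyhedron a b.
Proof.
move=> /finI_halfspaces[N [s [a [b [a0 ->]]]]]; set S := [set _ | _] => cS [p Sp].
exists N, a, b; split=> //; rewrite predeqE => x; split=> [Sx k|Qx].
  by have := Sx k; rewrite /halfspace /=; exact: lteifW.
have line : (fun e : R => x + e *: (p - x)) @ 0^'+ --> x.
  rewrite -[X in _ --> X]addr0 -(scale0r (p - x)); apply: cvgD; first exact: cvg_cst.
  by apply: cvgZ; [exact: cvg_at_right_filter | exact: cvg_cst].
apply: (closed_cvg S cS _ _ line); near=> e => k.
have e0 : 0 < e by near: e; exact: nbhs_right_gt.
have e1 : e < 1 by near: e; exact: nbhs_right_lt.
have := Sp k; have := Qx k; rewrite /halfspace /= -[- x]scale1r scalerN -scaleNr !dotDZr.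
by case: (s k) => /= ? ?; nra.
Unshelve. all: by end_near. Qed.

Lemma has_dim_full P : has_dim P d -> affine_hull P = setT.
Proof.
move=> [x0 [M [Mf ->]]]; rewrite predeqE => x; split=> // _.
have Mu : M \in unitmx by rewrite -row_free_unit.
by exists ((x - x0) *m invmx M) => //; rewrite mulmxKV // addrC subrK.
Qed.

End Polytope.

(** * Quasi-polynomials and denominators *)

Lemma period_dvd (T : Type) (c : int -> T) (D : nat) : has_period c D -> (period c %| D)%N.
Proof.
move=> cD; rewrite /period; case: xgetP => [p _ [[p0 cp] pmin]|none].
  have mulp (q : nat) t : c (t + (q * p)%N%:Z) = c t.
    elim: q t => [|q IH] t; first by rewrite mul0n addr0.
    by rewrite mulSn PoszD addrA IH cp.
  rewrite /dvdn; apply/negPn/negP => r0.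
  have : has_period c (D %% p)%N.
    split=> [|t]; first by rewrite lt0n.
    by rewrite -(mulp (D %/ p)%N) -addrA -PoszD addnC -divn_eq; case: cD.
  by move/pmin; rewrite leqNgt ltn_mod p0.
have [|p /asboolP cp pmin] := @ex_minnP (fun p => `[< has_period c p >]).
  by exists D; apply/asboolP.
by case: (none p); split=> // q cq; apply: pmin; apply/asboolP.
Qed.

Section QuasiPolyOfPolynomials.
Variables (d D : nat) (p : int -> {poly rat}).
Hypotheses (D0 : (0 < D)%N) (pD : forall t, p (t + D%:Z) = p t).

Lemma coef_has_period j : has_period (fun t => (p t)`_j) D.
Proof. by split=> // t; rewrite pD. Qed.

Definition poly_quasi_poly : quasi_poly d :=
  @QuasiPoly d (fun j t => (p t)`_j) (fun j => ex_intro _ D (coef_has_period j)).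

Lemma qp_eval_poly t : (size (p t) <= d.+1)%N -> qp_eval poly_quasi_poly t = (p t).[t%:~R].
Proof. by move=> sp; rewrite (horner_coef_wide _ sp). Qed.

End QuasiPolyOfPolynomials.

Lemma group_quasi_poly_exists (A : zmodType) (d D : nat) (T : finType) (x : T -> A)
    (p : T -> int -> {poly rat}) : (0 < D)%N ->
  (forall i t, p i (t + D%:Z) = p i t) -> (forall i t, (size (p i t) <= d.+1)%N) ->
  (forall i t, (p i t).[t%:~R] \is a Num.int) ->
  exists Q : group_quasi_poly A d,
  [/\ forall t, gqp_eval Q t = \sum_i x i *~ numq (p i t).[t%:~R],
      (gqp_period Q %| D)%N, D = 1%N -> gqp_polynomial Q
    & forall t, (forall N : nat, (0 < N)%N ->
        (forall i, N%:R * (p i t)`_d \is a Num.int) ->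
        \sum_i x i *~ numq (N%:R * (p i t)`_d) <> 0) -> gqp_degree_exact Q].
Proof.
move=> D0 pD sp ip; pose q i := poly_quasi_poly d D0 (pD i).
have qE i t : qp_eval (q i) t = (p i t).[t%:~R] by exact: qp_eval_poly.
have qi (i : 'I_#|T|) t : qp_eval (q (enum_val i)) t \is a Num.int by rewrite qE.
have sumE (F : T -> A) : \sum_(i < #|T|) F (enum_val i) = \sum_i F i.
  by rewrite [RHS](reindex _ (onW_bij _ (@enum_val_bij T))).
exists (@GroupQuasiPoly A d #|T| (fun i => x (enum_val i)) (fun i => q (enum_val i)) qi).
split=> [t|||t H].
- by rewrite -sumE; apply: eq_bigr => i _; rewrite qE.
- apply: (big_ind (fun m => m %| D)%N) => [|m1 m2 d1 d2|i _]; rewrite ?dvd1n ?dvdn_lcm ?d1 //.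
  apply: (big_ind (fun m => m %| D)%N) => [|m1 m2 d1 d2|j _]; rewrite ?dvd1n ?dvdn_lcm ?d1 //.
  exact/period_dvd/coef_has_period.
- move=> D1 i j s t; rewrite /gqp_coef /=; set c := p (enum_val i).
  have c1 r : c (r + 1) = c r by rewrite /c -[in RHS]pD D1.
  suff cE (m : nat) r : c (r + m%:Z) = c r.
    suff E r : c r = c 0 by rewrite (E s) (E t).
    have [r0|r0] := leP 0 r; first by case: r r0 => // m _; rewrite -[Posz m]add0r cE.
    by rewrite -(cE `|r|%N r); congr c; lia.
  by elim: m r => [|m IH] r; rewrite ?addr0 // -addn1 PoszD addrA c1 IH.
- exists t => -[N [N0 Ni S0]]; apply: (H N N0) => [i|].
    by have := Ni (enum_rank i); rewrite /gqp_coef /= enum_rankK.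
  by rewrite -(sumE (fun i => x i *~ numq (N%:R * (p i t)`_d))) -[RHS]S0.
Qed.

(** Of the negative integers, $-1,\dots,-k$ are roots and the others are reflected to nonnegative
    ones by [binomial_poly_sym]. *)
Lemma intr_horner_binomial_poly k (r : int) : (binomial_poly k).[r%:~R] \is a Num.int.
Proof.
have natP (m : nat) : (binomial_poly k).[m%:R] \is a Num.int by rewrite binomial_poly_nat.
case: r => m; first exact: natP.
rewrite NegzE mulrNz -pmulrn; have [mk|mk] := leqP m.+1 k.
  by rewrite binomial_poly_neg // rpred0.
have -> : - m.+1%:R = - (m - k)%N%:R - k.+1%:R :> rat.
  by rewrite (natrB _ (mk : (k <= m)%N)) -!natr1; ring.
by rewrite binomial_poly_sym rpredMsign.
Qed.

Lemma intr_horner_count_poly (D k H : nat) (c : nat -> nat) (t : int) : (0 < D)%N ->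
  (count_poly D k H c t).[t%:~R] \is a Num.int.
Proof.
move=> D0; rewrite horner_count_poly; apply: rpred_sum => h _.
case: ifP => [/dvdzP[q tq]|_]; last exact: rpred0.
rewrite (_ : (t%:~R - h%:R) / D%:R = q%:~R); last first.
  rewrite (_ : h%:R = h%:Z%:~R) // -intrB tq intrM mulfK //.
  by rewrite pnatr_eq0 -lt0n.
by rewrite rpredM ?intr_horner_binomial_poly // rpred_nat.
Qed.

(** * The denominator clears the coordinates of all vertices *)

Section Denominator.
Variables (R : realType) (d : nat) (P : set 'rV[R]_d).
Hypotheses (fP : finite_set (vertex P)) (rP : rational_vertices P).

Lemma ratv_inj : injective (@ratv R d).
Proof. by apply: map_mx_inj; exact: fmorph_inj. Qed.

Lemma denominatorE : denominator P =
  \big[lcmn/1%N]_(q <- fset_set [set q | vertex P (ratv R q)]) vec_denom q.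
Proof.
apply: fsbig_finite; apply: finite_preimage => // x y _ _; exact: ratv_inj.
Qed.

Lemma vec_denom_gt0 (q : 'rV[rat]_d) : (0 < vec_denom q)%N.
Proof.
apply: (big_ind (fun m => 0 < m)%N) => [|m1 m2 ? ?|i _] //; first by rewrite lcmn_gt0; apply/andP.
by rewrite absz_gt0 denq_neq0.
Qed.

Lemma denominator_gt0 : (0 < denominator P)%N.
Proof.
rewrite denominatorE; apply: (big_ind (fun m => 0 < m)%N) => [|m1 m2 ? ?|q _] //.
  by rewrite lcmn_gt0; apply/andP.
exact: vec_denom_gt0.
Qed.

Lemma denominator_vertex x : vertex P x ->
  exists z : 'rV[int]_d, intv R z = (denominator P)%:R *: x.
Proof.
move=> /[dup] vx /rP[q _ qx].
have qD : (vec_denom q %| denominator P)%N.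
  rewrite denominatorE (bigD1_seq q) ?fset_uniq ?dvdn_lcml //=.
  rewrite in_fset_set; first by rewrite inE /= qx.
  by apply: finite_preimage => // ? ? _ _; exact: ratv_inj.
exists (\row_i numq ((denominator P)%:R * q 0 i)); apply/matrixP => i j.
rewrite ord1 !mxE -qx mxE -[(denominator P)%:R in RHS](ratr_nat R) -rmorphM /=.
suff /intrP[m ->] : (denominator P)%:R * q 0 j \is a Num.int by rewrite numq_int ratr_int.
have : (absz (denq (q 0%R j)) %| denominator P)%N.
  by apply: dvdn_trans qD; rewrite /vec_denom (bigD1 j) //= dvdn_lcml.
case/dvdnP => m ->; rewrite natrM -mulrA [_ * q 0 j]mulrC.
have -> : (absz (denq (q 0 j)))%:R = (denq (q 0 j))%:~R :> rat.
  by rewrite -[in RHS](gez0_abs (denq_ge0 _)).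
by rewrite -numqE rpredM ?rpred_nat ?rpred_int.
Qed.

Lemma denominator_integral : integral_vertices P -> denominator P = 1%N.
Proof.
move=> iP; rewrite denominatorE big_seq big1 // => q.
rewrite in_fset_set; last by apply: finite_preimage => // ? ? _ _; exact: ratv_inj.
rewrite inE => /= /iP[z _ zq]; rewrite /vec_denom big1 // => i _.
suff -> : q 0 i = (z 0 i)%:~R by rewrite denq_int.
apply: (fmorph_inj (@ratr R)); rewrite /= ratr_int.
by have /matrixP/(_ 0 i) := zq; rewrite !mxE.
Qed.

End Denominator.

(** * Tangent cones of dilated polytopes *)

Lemma sum_ncard (T : choiceType) (A : zmodType) (s : {fset T}) (X : set T) (x : A) :
  (forall m, X m -> m \in s) ->
  \sum_(m <- s) (if m \in X then x else 0) = x *+ ncard X.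
Proof.
move=> Xs; have fX : finite_set X.
  by apply: sub_finite_set (finite_fset s) => m /Xs.
rewrite -big_mkcond big_const_seq iter_addr_0; congr (_ *+ _).
rewrite -size_filter; apply/perm_size/uniq_perm; rewrite ?filter_uniq ?fset_uniq // => m.
rewrite mem_filter in_fset_set //; case mX: (m \in X) => //=.
by rewrite Xs //; exact: set_mem.
Qed.

Lemma tangent_coneE (R : realType) d (X : set 'rV[R]_d) m y :
  tangent_cone X m y <-> \forall e \near (0 : R)^'+, X (m + e *: y).
Proof.
split=> [H|H].
  have : \forall e \near (0 : R)^'+, `|1 - \1_X (m + e *: y)| < 1 :> R.
    by move/cvgrPdist_lt: H; apply.
  apply: filterS => e; rewrite indicE; case: (boolP (_ \in X)) => [/set_mem//|_].
  by rewrite subr0 normr1 ltxx.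
apply: cvg_near_cst; apply: filterS H => e Xe.
by rewrite indicE mem_set.
Qed.

Section ConeOverPolytope.
Variables (R : realType) (d N : nat) (a : 'I_N -> 'rV[R]_d) (b : 'I_N -> R).
Variables (n : nat) (pt : 'I_n -> 'rV[R]_d).
Local Notation Q := (polyhedron a b).
Local Notation G := (hommx pt).
Hypotheses (bQ : bounded_set Q) (Qpt : forall i, vertex Q (pt i)).
Hypothesis ptQ : forall x, vertex Q x -> exists i, x = pt i.

Lemma cone_hom_le x t : in_cone G (hom x t) -> forall k, dot (a k) x <= t * b k.
Proof.
move=> [l l0 /mul_hommx[<- <-]] k; rewrite dot_sumr mulr_suml; apply: ler_sum => i _.
by rewrite ler_wpM2l //; have /vertexP[] := Qpt i.
Qed.

(** At height 1 this is Minkowski's theorem: the [y] with [hom y 1] in the cone form a convex set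
    containing the vertices. Other heights follow by scaling. *)
Lemma cone_hom x t : 0 < t -> (in_cone G (hom x t) <-> forall k, dot (a k) x <= t * b k).
Proof.
move=> t0; split; first exact: cone_hom_le.
move=> H; suff c1 : in_cone G (hom (t^-1 *: x) 1).
  by have := in_coneZ (ltW t0) c1; rewrite -homZ scalerA mulfV ?gt_eqF // scale1r mulr1.
have : Q (t^-1 *: x) by move=> k; rewrite dotZr mulrC ler_pdivrMr // mulrC.
apply: (polyhedron_hull (C := [set y | in_cone G (hom y 1)])) => //.
  move=> y /ptQ[i ->]; exists (delta_mx 0 i); first by move=> j; rewrite mxE ler0n.
  by rewrite -rowE row_hommx.
move=> y y' s /andP[s0 s1] /= cy cy'.
have -> : hom (y + s *: (y' - y)) 1 = (1 - s) *: hom y 1 + s *: hom y' 1.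
  rewrite -!homZ -homD mulr1 mulr1 subrK; congr hom.
  by rewrite scalerBr scalerBl scale1r addrA addrAC.
by apply: in_coneD; apply: in_coneZ => //; rewrite subr_ge0.
Qed.

(** [height] is listed so that interior points have [0 < t], as [cone_hom] requires. *)
Definition facet_forms : seq 'cV[R]_(d + 1) :=
  height R d :: [seq col_mx (- (a k)^T) (b k)%:M | k <- enum 'I_N].

Lemma hom_facet x t k :
  (hom x t *m col_mx (- (a k)^T) (b k)%:M) 0 0 = t * b k - dot (a k) x.
Proof.
rewrite mul_row_col mulmxN -scalar_mxM addrC !mxE mulr1n; congr (_ - _).
by apply: eq_bigr => i _; rewrite mxE mulrC.
Qed.

Lemma hom_height00 x t : (hom x t *m height R d) 0 0 = t.
Proof. by rewrite hom_height mxE mulr1n. Qed.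

Lemma interior_hom x t :
  in_interior facet_forms (hom x t) <-> 0 < t /\ forall k, dot (a k) x < t * b k.
Proof.
split=> [H|[t0 H] f].
  split=> [|k]; first by rewrite -(hom_height00 x t); apply: H; rewrite inE eqxx.
  rewrite -subr_gt0 -hom_facet; apply: H; rewrite inE; apply/orP; right.
  by apply: map_f; rewrite mem_enum.
rewrite inE => /orP[/eqP->|/mapP[k _ ->]]; first by rewrite hom_height00.
by rewrite hom_facet subr_gt0.
Qed.

Lemma hom_surj (X : 'rV[R]_(d + 1)) : exists x t, X = hom x t.
Proof. by exists (lsubmx X), (rsubmx X 0 0); rewrite /hom -mx11_scalar hsubmxK. Qed.

Lemma facet_interior_cone X : in_interior facet_forms X -> in_cone G X.
Proof.
have [x [t ->]] := hom_surj X; move=> /interior_hom[t0 H].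
by apply/cone_hom => // k; apply/ltW/H.
Qed.

Lemma facet_cone_ge0 X : in_cone G X -> forall f, f \in facet_forms -> 0 <= (X *m f) 0 0.
Proof.
have [x [t ->]] := hom_surj X; move=> cX f.
rewrite inE => /orP[/eqP->|/mapP[k _ ->]].
  rewrite hom_height00; have [l l0 /mul_hommx[_ <-]] := cX.
  by apply: sumr_ge0 => i _; apply: l0.
by rewrite hom_facet subr_ge0; apply: cone_hom_le.
Qed.

Lemma dilate_polyhedron (t : nat) x : (0 < t)%N ->
  dilate t Q x <-> in_cone G (hom x t%:R).
Proof.
move=> t0; have t0R : (0 : R) < t%:R by rewrite ltr0n.
rewrite (cone_hom _ t0R); split=> [[y Qy <-] k|H].
  by rewrite dotZr ler_pM2l.
exists (t%:R^-1 *: x); last by rewrite scalerA mulfV ?scale1r // gt_eqF.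
by move=> k; rewrite dotZr mulrC ler_pdivrMr // mulrC.
Qed.

Lemma dilate_opp_interior (t : nat) x : (0 < t)%N ->
  dilate t (opp_set (polyhedron_interior a b)) x <->
  in_interior facet_forms (hom (- x) t%:R).
Proof.
move=> t0; have t0R : (0 : R) < t%:R by rewrite ltr0n.
rewrite interior_hom; split=> [[_ [y iy <-] <-]|[_ H]].
  by split=> // k; rewrite scalerN opprK dotZr ltr_pM2l.
exists (t%:R^-1 *: x); last by rewrite scalerA mulfV ?scale1r // gt_eqF.
exists (- (t%:R^-1 *: x)); last by rewrite opprK.
by move=> k; rewrite -scalerN dotZr mulrC ltr_pdivrMr // mulrC.
Qed.

Variables (w : 'cV[R]_n) (u : 'rV[R]_(d + 1)).
Hypotheses (gw : generic_cost G w) (gu : generic G u).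
Hypothesis iu : in_interior facet_forms u.
Local Notation S := (simplices G w).

Definition coord_form (J : {set 'I_n}) j : 'rV[R]_d := (col j (usubmx (coord G J)))^T.

Lemma coord_formE J j y : (hom y 0 *m coord G J) 0 j = dot (coord_form J j) y.
Proof.
rewrite /hom raddf0 -[coord G J in LHS]vsubmxK mul_row_col mul0mx addr0 mxE.
by apply: eq_bigr => i _; rewrite !mxE mulrC.
Qed.

Definition half (J : {set 'I_n}) j : set 'rV[R]_d :=
  [set y | 0 < dot (coord_form J j) y ?<= if (0 < (u *m coord G J) 0 j)].

Definition zeros (J : {set 'I_n}) (l : 'rV[R]_n) : {set 'I_n} :=
  [set j in J | l 0 j == 0]%SET.

(** A positive coordinate constrains no direction, a negative one excludes all, and a zero one
    leaves a half-space. For [o] true the direction is negated and the flag flipped, which together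
    give the complement. *)
Lemma lexcell_meet (o : bool) J M :
  [set y | lexcell G u o J M (hom ((-1) ^+ o *: y) 0)] =
  if [forall (j | j \in J), 0 <= (M *m coord G J) 0 j] then
    meet (zeros J (M *m coord G J)) (fun j => if o then ~` half J j else half J j)
  else set0.
Proof.
set l := M *m coord G J; rewrite predeqE => y /=.
have E j : l 0 j = 0 ->
    lexpos ((0 < (u *m coord G J) 0 j) (+) o) (l 0 j) ((hom ((-1) ^+ o *: y) 0 *m coord G J) 0 j)
    <-> (if o then ~` half J j else half J j) y.
  move=> ->; rewrite /lexpos ltxx eqxx /= coord_formE dotZr /half.
  case: (o); rewrite ?expr0 ?expr1 ?mul1r ?mulN1r ?addbF ?addbT //=.
  set s := 0 < _; rewrite (_ : (0 < - _ ?<= if ~~ s) = ~~ (0 < dot (coord_form J j) y ?<= if s)).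
    by split=> /negP.
  by case: s; rewrite /= ?oppr_gt0 ?oppr_ge0 -?ltNge -?leNgt.
split=> [/forall_inP H|].
  rewrite ifT => [j|]; last first.
    by apply/forall_inP => j /H /orP[/ltW//|/andP[/eqP-> _]].
  by rewrite inE => /andP[/H lj /eqP l0]; apply/E.
case: ifP => // /forall_inP l0 H; apply/forall_inP => j jJ.
have [lj|lj] := eqVneq (l 0 j) 0; last by rewrite /lexpos lt_neqAle eq_sym lj l0.
by apply/E => //; apply: H; rewrite inE jJ lj eqxx.
Qed.

Variables (A : zmodType) (v : set 'rV[R]_d -> A).
Hypotheses (vv : valuation (@cone_lattice R d) v) (v0 : v set0 = 0).

Definition compl_value (J Y : {set 'I_n}) : A := v (meet Y (fun j => ~` half J j)).

Lemma lexcell_lattice (o : bool) J M :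
  cone_lattice0 [set y | lexcell G u o J M (hom ((-1) ^+ o *: y) 0)].
Proof.
rewrite lexcell_meet; case: ifP => _; last by right.
by apply: cone_lattice0_meet => j; case: (o);
  [exact: cone_lattice0_halfC | exact: cone_lattice0_half].
Qed.

Lemma valuation_lexcells (o : bool) M :
  v [set y | exists2 J, J \in S & lexcell G u o J M (hom ((-1) ^+ o *: y) 0)] =
  \sum_(J in S) if [forall (j | j \in J), 0 <= (M *m coord G J) 0 j] then
    if o then compl_value J (zeros J (M *m coord G J)) else
    \sum_(Y : {set 'I_n} | Y \subset zeros J (M *m coord G J))
      compl_value J Y *~ (-1) ^+ #|Y|
  else 0.
Proof.
rewrite (valuation_disjoint vv v0
  (F := fun J => [set y | lexcell G u o J M (hom ((-1) ^+ o *: y) 0)])); last 2 first.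
- by move=> J _; exact: lexcell_lattice.
- by move=> J J' y JS JS' /= H1 H2; exact: (lexcell_unique gu JS JS' H1 H2).
apply: eq_bigr => J JS; rewrite lexcell_meet; case: ifP => // _.
case: (o) => //=; rewrite (valuation_meet_compl vv v0) // => j.
  exact: cone_lattice0_half.
exact: cone_lattice0_halfC.
Qed.

Lemma tangent_cone_dilate (t : nat) m : (0 < t)%N ->
  tangent_cone (dilate t Q) m =
  [set y | exists2 J, J \in S & lexcell G u false J (hom m t%:R) (hom ((-1) ^+ false *: y) 0)].
Proof.
move=> t0; rewrite predeqE => y; rewrite tangent_coneE /=.
have -> : (-1) ^+ false *: y = y by rewrite expr0 scale1r.
rewrite -(near_lexcells _ _ (cone_cells (hommx_height pt) gw facet_interior_cone gu iu)).
have E e : hom (m + e *: y) t%:R = hom m t%:R + e *: hom y 0.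
  by rewrite -homZ -homD mulr0 addr0.
split; apply: filterS => e; first by move/dilate_polyhedron; rewrite E; apply.
by rewrite -E => H; apply/dilate_polyhedron.
Qed.

Lemma tangent_cone_dilate_opp (t : nat) m : (0 < t)%N ->
  tangent_cone (dilate t (opp_set (polyhedron_interior a b))) (- m) =
  [set y | exists2 J, J \in S & lexcell G u true J (hom m t%:R) (hom ((-1) ^+ true *: y) 0)].
Proof.
move=> t0; rewrite predeqE => y; rewrite tangent_coneE /=.
have -> : (-1) ^+ true *: y = - y by rewrite expr1 scaleN1r.
rewrite -(near_lexcells _ _
  (interior_cells (hommx_height pt) gw facet_interior_cone facet_cone_ge0 gu iu)).
have E e : hom (- (- m + e *: y)) t%:R = hom m t%:R + e *: hom (- y) 0.
  by rewrite -homZ -homD mulr0 addr0 opprD opprK scalerN.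
split; apply: filterS => e; first by move/dilate_opp_interior; rewrite E; apply.
by rewrite -E => H; apply/dilate_opp_interior.
Qed.

Variable D : nat.

Local Notation points o J B t := (box_points pt D J o B B t).

(** Taking [Act] equal to [B] lifts the confinement to the fundamental box. The right-hand sides are
    the index conditions of [valuation_lexcells], so exchanging sums leaves point counts as
    coefficients. *)
Lemma box_pointsP (o : bool) (J Y : {set 'I_n}) m (t : int) : Y \subset J ->
  points o J (J :\: Y) t m <->
  [forall (j | j \in J), 0 <= bary pt J m t 0 j] /\
  (if o then Y = zeros J (bary pt J m t) else Y \subset zeros J (bary pt J m t)).
Proof.
move=> YJ; set l := bary pt J m t; split=> [H|[/forall_inP l0 HY] j jJ].
  have Hl j : j \in J -> if j \in Y then l 0 j = 0 else (0 < l 0 j ?<= if ~~ o).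
    by move=> jJ; have := H j jJ; rewrite !inE jJ andbT; case: (j \in Y) => /= [/eqP|/andP[]].
  have YZ : Y \subset zeros J l.
    apply/fintype.subsetP => j jY; have jJ := fintype.subsetP YJ j jY.
    by rewrite inE jJ; apply/eqP; have := Hl j jJ; rewrite jY.
  split; first by apply/forall_inP => j /Hl; case: ifP => [_ ->//|_ /lteifW].
  case: (o) Hl => // Hl; apply/eqP; rewrite finset.eqEsubset YZ /=.
  apply/fintype.subsetP => j; rewrite inE => /andP[jJ /eqP lj].
  by apply: contraT => jY; have := Hl j jJ; rewrite (negPf jY) lj /= ltxx.
rewrite !inE jJ andbT; have lj := l0 j jJ.
case: (o) HY => HY.
  by rewrite HY inE jJ /=; case: eqP => //= /eqP lj0; rewrite lt_neqAle eq_sym lj0 lj.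
case: ifP => [|/negbFE /(fintype.subsetP HY)]; first by rewrite /= lj => ->.
by rewrite inE => /andP[].
Qed.

Lemma sum_over_points (o : bool) (t : int) (F : {set 'I_n} -> {set 'I_n} -> A)
    (s : {fset 'rV[int]_d}) :
  (forall J m, J \in S -> (forall j, j \in J -> 0 <= bary pt J m t 0 j) -> m \in s) ->
  \sum_(m <- s) \sum_(J in S) (if [forall (j | j \in J), 0 <= bary pt J m t 0 j] then
      if o then F J (zeros J (bary pt J m t)) else
      \sum_(Y : {set 'I_n} | Y \subset zeros J (bary pt J m t)) F J Y else 0) =
  \sum_(J in S) \sum_(Y : {set 'I_n} | Y \subset J) F J Y *+ ncard (points o J (J :\: Y) t).
Proof.
move=> Hs; rewrite exchange_big /=; apply: eq_bigr => J JS.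
transitivity (\sum_(m <- s) \sum_(Y : {set 'I_n} | Y \subset J)
    if m \in points o J (J :\: Y) t then F J Y else 0); last first.
  rewrite exchange_big /=; apply: eq_bigr => Y YJ; apply: sum_ncard => m.
  by move/(box_pointsP _ _ _ YJ) => [/forall_inP H _]; apply: (Hs J).
apply: eq_bigr => m _; have zJ : zeros J (bary pt J m t) \subset J.
  by apply/fintype.subsetP => j; rewrite inE => /andP[].
have inP (Y : {set 'I_n}) : Y \subset J -> (m \in points o J (J :\: Y) t) =
    [forall (j | j \in J), 0 <= bary pt J m t 0 j] &&
    (if o then Y == zeros J (bary pt J m t) else Y \subset zeros J (bary pt J m t)).
  move=> YJ; apply/idP/idP => [/set_mem/(box_pointsP _ _ _ YJ)[-> /=]|].
    by case: (o) => // ->.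
  move=> /andP[l0 HY]; apply/mem_set/(box_pointsP _ _ _ YJ); split=> //.
  by case: (o) HY => // /eqP.
case: ifP => l0; last by rewrite big1 // => Y YJ; rewrite inP // l0.
case: (o) inP => inP.
  rewrite (bigD1 (zeros J (bary pt J m t))) //= inP // l0 eqxx /= big1 ?addr0 // => Y.
  by move=> /andP[YJ /negPf nY]; rewrite inP // l0 nY.
rewrite -big_mkcondr /=; apply: eq_bigl => Y.
have [YJ|nYJ] := boolP (Y \subset J); first by rewrite inP // l0.
by apply: contraNF nYJ => /fintype.subset_trans; apply.
Qed.

Lemma finite_points (t : int) : exists s : {fset 'rV[int]_d}, forall J m, J \in S ->
  (forall j, j \in J -> 0 <= bary pt J m t 0 j) -> m \in s.
Proof.
pose X J := [set m | J \in S /\ forall j, j \in J -> 0 <= bary pt J m t 0 j].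
have fX : finite_set (\bigcup_(J in [set: {set 'I_n}]) X J).
  apply: bigcup_finite; first exact: finite_finset.
  move=> J _; have [JS|nJS] := boolP (J \in S).
    apply: sub_finite_set (finite_bary_ge0 (simplices_basis JS) t).
    by move=> m [].
  by rewrite (_ : X J = set0) // predeqE => m; split=> // -[]; rewrite (negPf nJS).
exists (fset_set (\bigcup_(J in [set: {set 'I_n}]) X J)) => J m JS Hm.
by rewrite in_fset_set //; apply/mem_set; exists J.
Qed.

Lemma V_polyhedron (t : nat) : (0 < t)%N -> V v Q t =
  \sum_(J in S) \sum_(Y : {set 'I_n} | Y \subset J)
    (compl_value J Y *~ (-1) ^+ #|Y|) *+ ncard (points false J (J :\: Y) t).
Proof.
move=> t0; have [s Hs] := finite_points t.
rewrite -(sum_over_points false (fun J Y => compl_value J Y *~ (-1) ^+ #|Y|) Hs).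
have E m : v (tangent_cone (dilate t Q) (intv R m)) = _ :=
  etrans (congr1 v (tangent_cone_dilate _ t0)) (valuation_lexcells false _).
rewrite /V (fsbigTE s) => [|m ms]; first by apply: eq_bigr => m _; rewrite E.
rewrite E big1 // => J JS; rewrite ifF //; apply/negP => /forall_inP H.
by move/negP: ms; apply; apply: (Hs J).
Qed.

Lemma V_opp_interior (t : nat) : (0 < t)%N -> V v (opp_set (polyhedron_interior a b)) t =
  \sum_(J in S) \sum_(Y : {set 'I_n} | Y \subset J)
    compl_value J Y *+ ncard (points true J (J :\: Y) t).
Proof.
move=> t0; have [s Hs] := finite_points t.
rewrite -(sum_over_points true compl_value Hs).
have E m : v (tangent_cone (dilate t (opp_set (polyhedron_interior a b)))
    (- intv R m)) = _ :=
  etrans (congr1 v (tangent_cone_dilate_opp _ t0)) (valuation_lexcells true _).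
(* The tangent cones are known at [- m], so the lattice is reflected first. *)
rewrite /V (reindex_fsbigT (fun m => - m)); last by exists -%R => m; rewrite opprK.
rewrite (fsbigTE s) => [|m ms]; first by apply: eq_bigr => m _; rewrite intvN E.
rewrite intvN E big1 // => J JS; rewrite ifF //; apply/negP => /forall_inP H.
by move/negP: ms; apply; apply: (Hs J).
Qed.

End ConeOverPolytope.

(** * Reciprocity *)

Section Ehrhart.
Variables (R : realType) (d n : nat) (pt : 'I_n -> 'rV[R]_d) (z : 'I_n -> 'rV[int]_d).
Variable D : nat.
Hypotheses (D0 : (0 < D)%N) (Hz : forall i, intv R (z i) = D%:R *: pt i).
Variables (J B : {set 'I_n}).
Hypotheses (bJ : is_basis (hommx pt) J (coord (hommx pt) J)) (BJ : B \subset J).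

Definition ehrhart : int -> {poly rat} :=
  count_poly D #|B|.-1 (D * #|B|) (fun h => ncard (box_points pt D J false B finset.set0 h)).

(** The empty face carries only the apex of the cone, which has height 0. *)
Lemma points_set0 o (t : nat) : B = finset.set0 -> (0 < t)%N ->
  ncard (box_points pt D J o B B t) = 0%N.
Proof.
move=> B0 t0; rewrite (_ : box_points _ _ _ _ _ _ _ = set0) ?ncard_set0 // predeqE => m.
split=> // H; have [_ E] := bary_combination bJ m t.
suff : (t%:R : R) = 0 by move/eqP; rewrite pnatr_eq0 gtn_eqF.
rewrite -[LHS]E big1 // => j _; have [jJ|jJ] := boolP (j \in J); last by rewrite bary_off.
by have := H j jJ; rewrite B0 inE => /eqP.
Qed.

Hypothesis B0 : B != finset.set0.

Let B1 : #|B| = #|B|.-1.+1.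
Proof. by rewrite prednK // card_gt0. Qed.

Lemma ehrhart_closed (t : nat) : (0 < t)%N ->
  (ehrhart t).[t%:R] = (ncard (box_points pt D J false B B t))%:R.
Proof.
move=> t0; rewrite (ncard_box_points D0 Hz bJ) ?fintype.subxx //.
under eq_bigr do rewrite [X in multiples_count D X _]B1.
by rewrite -count_poly_closed // -B1.
Qed.

Lemma ehrhart_open (t : nat) : (0 < t)%N ->
  (ehrhart (- t%:Z)).[- t%:R] =
  (-1) ^+ #|B|.-1 * (ncard (box_points pt D J true B B t))%:R.
Proof.
move=> t0; rewrite (ncard_box_points D0 Hz bJ) ?fintype.subxx //.
have -> : (\sum_(h < (D * #|B|).+1) ncard (box_points pt D J true B finset.set0 h) *
    multiples_count D #|B| (t%:Z - h%:Z) = \sum_(h < (D * #|B|).+1)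
    ncard (box_points pt D J false B finset.set0 (D * #|B| - h)%N) *
    multiples_count D #|B|.-1.+1 (t%:Z - h%:Z))%N.
  apply: eq_bigr => h _; rewrite -B1 (box_points_sym D0 Hz bJ) //.
  by rewrite subzn // -ltnS.
rewrite (count_poly_open (fun h => ncard (box_points pt D J false B finset.set0 h))) // -?B1 //.
by rewrite signrMK.
Qed.

Lemma size_ehrhart t : (size (ehrhart t) <= #|B|)%N.
Proof. by rewrite [leqRHS]B1; exact: size_count_poly. Qed.

(** At [t = 0] the term [h = 0] is present and counts the origin; all other terms are
    nonnegative. *)
Lemma ehrhart_lead_gt0 : 0 < (ehrhart 0)`_(#|B|.-1).
Proof.
rewrite coef_count_poly // (bigD1 ord0) /=; last by rewrite subrr dvdz0.
apply: ltr_pwDl.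
  rewrite divr_gt0 ?mulr_gt0 ?exprn_gt0 ?ltr0n ?fact_gt0 //.
  apply: (ncard_gt0 (x := 0)); first exact: finite_box_points.
  move=> j jJ; rewrite bary0 mxE inE; case: ifP => // _.
  by rewrite /= lexx sub0r oppr_ge0 -ltNge ltr0n.
by apply: sumr_ge0 => h _; rewrite divr_ge0 ?mulr_ge0 ?exprn_ge0.
Qed.

End Ehrhart.

Section Main.
Variables (R : realType) (d N : nat) (a : 'I_N -> 'rV[R]_d) (b : 'I_N -> R).
Local Notation Q := (polyhedron a b).
Variables (A : zmodType) (v : set 'rV[R]_d -> A).
Hypotheses (vv : valuation (@cone_lattice R d) v) (v0 : v set0 = 0).
Hypotheses (bQ : bounded_set Q) (a0 : forall k, a k != 0) (hullT : affine_hull Q = setT).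
Hypothesis rQ : rational_vertices Q.

Lemma enumerate_vertices : exists n (pt : 'I_n -> 'rV[R]_d),
  (forall i, vertex Q (pt i)) /\ (forall x, vertex Q x -> exists i, x = pt i).
Proof.
pose s : seq 'rV[R]_d := fset_set (vertex Q).
have sP x : x \in s <-> vertex Q x.
  by rewrite /s in_fset_set; [split => [/set_mem | /mem_set] | exact: finite_vertex].
exists (size s), (fun i => nth 0 s i); split=> [i|x /sP xs]; first exact/sP/mem_nth.
have xi : (index x s < size s)%N by rewrite index_mem.
by exists (Ordinal xi); rewrite /= nth_index.
Qed.

Lemma polyhedron_reciprocity : exists Qp : group_quasi_poly A d,
  [/\ forall t : nat, (0 < t)%N -> gqp_eval Qp t%:Z = V v Q t,
      infinite_order (v setT) -> gqp_degree_exact Qp,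
      (gqp_period Qp %| denominator Q)%N,
      integral_vertices Q -> gqp_polynomial Qp
    & forall t : nat, (0 < t)%N ->
        gqp_eval Qp (- t%:Z) = V v (opp_set (polyhedron_interior a b)) t *~ (-1) ^+ d].
Proof.
have fV := @finite_vertex _ _ _ a b.
have D0 := denominator_gt0 fV; set D := denominator Q in D0 *.
have [n [pt [Qpt ptQ]]] := enumerate_vertices.
have /choice[z Hz] i : exists z, intv R z = D%:R *: pt i by exact: denominator_vertex.
set G := hommx pt.
have [w gw] := generic_cost_exists G.
have [x0 ix0] := interior_point a0 hullT.
have [|u gu iu] := @generic_exists _ _ _ G (facet_forms a b) (hom x0 1).
  by apply/interior_hom; split=> // k; rewrite mul1r.
set S := simplices G w.
have bS J : J \in S -> is_basis G J (coord G J) by exact: simplices_basis.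
have cS J : J \in S -> #|J| = d.+1 by move=> /bS/card_basis; rewrite addn1.
pose c J Y := compl_value pt u v J Y.
(* [Y = J] is excluded: it counts no points at positive heights, and [#|J :\: Y|.-1] would be a
   truncated predecessor. *)
pose good (q : {set 'I_n} * {set 'I_n}) := (q.1 \in S) && (q.2 \proper q.1).
pose p q t := if good q then ehrhart pt D q.1 (q.1 :\: q.2) t else 0.
pose x q := c q.1 q.2 *~ (-1) ^+ #|q.2|.
have goodP q : good q -> [/\ q.1 \in S, q.2 \subset q.1, q.1 :\: q.2 != finset.set0
    & (#|q.1 :\: q.2| + #|q.2|)%N = d.+1].
  move=> /andP[qS /[dup] /proper_sub q21 /properP[_ [j j1 j2]]]; split=> //.
    by apply/set0Pn; exists j; rewrite inE j2.
  by rewrite -(cS _ qS) -(cardsID q.2 q.1) (finset.setIidPr q21) addnC.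
have [i t|q t|q t|Qp [evalE perD pol lead]] := @group_quasi_poly_exists A d D _ x p D0.
- by rewrite /p /ehrhart count_poly_periodic.
- rewrite /p; case: ifP => [/goodP[qS q21 q0 cq]|_]; last by rewrite size_poly0.
  by rewrite (leq_trans (size_ehrhart _ _ _ q0 _)) // -cq leq_addr.
- rewrite /p; case: ifP => _; last by rewrite horner0 rpred0.
  exact: intr_horner_count_poly.
have sumE (F : {set 'I_n} * {set 'I_n} -> A) :
    (forall q : {set 'I_n} * {set 'I_n}, ~~ ((q.1 \in S) && (q.2 \subset q.1)) -> F q = 0) ->
    \sum_q F q = \sum_(J in S) \sum_(Y : {set 'I_n} | Y \subset J) F (J, Y).
  move=> F0; rewrite (pair_big_dep _ _ (fun J Y => F (J, Y))) /= [RHS]big_mkcond /=.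
  by apply: eq_bigr => -[J Y] _ /=; case: ifPn => // H; apply: (F0 (J, Y)).
have not_good (q : {set 'I_n} * {set 'I_n}) :
    ~~ ((q.1 \in S) && (q.2 \subset q.1)) -> good q = false.
  by move=> H; apply: contraNF H => /goodP[-> ->].
have good_or (J Y : {set 'I_n}) : J \in S -> Y \subset J -> good (J, Y) \/ J :\: Y = finset.set0.
  move=> JS YJ; rewrite /good JS properE YJ /=.
  have [JY|JY] := boolP (J \subset Y); last by left.
  by right; apply/eqP; rewrite finset.setD_eq0.
exists Qp; split=> [t t0|vinf||iQ|t t0] //.
- rewrite evalE (V_polyhedron bQ Qpt ptQ gw gu iu vv v0 D) // sumE => [|q /not_good]; last first.
    by rewrite /p => ->; rewrite horner0 mulr0z.
  apply: eq_bigr => J JS; apply: eq_bigr => Y YJ; rewrite /x /p /=.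
  have [gJ|JY] := good_or _ _ JS YJ.
    rewrite gJ; have [_ _ JY0 _] := goodP _ gJ.
    rewrite (ehrhart_closed D0 Hz (bS _ JS) _ JY0) ?finset.subDset ?finset.subsetUr //.
    by rewrite -[_%:R]/((ncard _)%:Z%:~R) numq_int.
  rewrite (points_set0 D (bS _ JS) _ JY) // mulr0n ifF ?horner0 ?mulr0z //.
  by apply/negP => /goodP[_ _]; rewrite JY eqxx.
(* For nonempty [Y] the polynomial has degree below [d], and for empty [Y] the group element is
   [v setT], so only a positive multiple of [v setT] is left. *)
- apply: (lead 0) => N0 N0_gt0 int_lead.
  have lead_eq q : x q *~ numq (N0%:R * (p q 0)`_d) =
      v setT *~ (if (q.1 \in S) && (q.2 == finset.set0) then
        numq (N0%:R * (ehrhart pt D q.1 q.1 0)`_d) else 0).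
    rewrite /p; case gq: (good q); last first.
      rewrite coef0 mulr0 mulr0z; case: ifP => [/andP[qS /eqP q2]|_]; last by rewrite mulr0z.
      by move: gq; rewrite /good qS q2 proper0 -card_gt0 cS.
    have [qS q21 q0 cq] := goodP _ gq; rewrite qS /=; case: eqP => [q2|/eqP q2].
      by rewrite /x /c /compl_value q2 meet0 cards0 expr0 finset.setD0.
    rewrite nth_default ?mulr0 ?mulr0z // (leq_trans (size_ehrhart _ _ _ q0 _)) //.
    by rewrite -ltnS -cq -[X in (X < _)%N]addn0 ltn_add2l card_gt0.
  rewrite (eq_bigr _ (fun q _ => lead_eq q)) -mulrz_sumr.
  set m := \sum_q _.
  suff m0 : 0 < m.
    by case: m m0 => // -[//|m] _; apply: vinf.
  have lead_gt0 J : J \in S -> 0 < numq (N0%:R * (ehrhart pt D J J 0)`_d).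
    move=> JS; rewrite numq_gt0 mulr_gt0 ?ltr0n //.
    by have := ehrhart_lead_gt0 D0 J (bS _ JS); rewrite (cS _ JS).
  (* [u] itself lies in the cone, so the triangulation has at least one simplex. *)
  have [J JS _] := (cone_cells (hommx_height pt) gw (facet_interior_cone bQ Qpt ptQ) gu iu u).1
    (facet_interior_cone bQ Qpt ptQ iu).
  rewrite /m (bigD1 (J, finset.set0)) //= JS eqxx /= ltr_pwDl ?lead_gt0 //.
  apply: sumr_ge0 => q _; case: ifP => // /andP[qS _]; exact/ltW/lead_gt0.
- by apply: pol; exact: denominator_integral.
- rewrite evalE (V_opp_interior bQ Qpt ptQ gw gu iu vv v0 D) // sumE => [|q /not_good]; last first.
    by rewrite /p => ->; rewrite horner0 mulr0z.
  rewrite mulrz_suml; apply: eq_bigr => J JS; rewrite mulrz_suml; apply: eq_bigr => Y YJ.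
  rewrite /x /p /=.
  have [gJ|JY] := good_or _ _ JS YJ.
    rewrite gJ; have [_ _ JY0 cJY] := goodP _ gJ.
    rewrite mulrNz (ehrhart_open D0 Hz (bS _ JS) _ JY0) ?finset.subDset ?finset.subsetUr //.
    set k := #|J :\: Y|.-1; set m := ncard _.
    rewrite (_ : (-1) ^+ k * m%:R = ((-1) ^+ k * m%:Z)%:~R); last first.
      by rewrite intrM rmorphXn /= mulrN1z.
    rewrite numq_int -mulrzA mulrA -exprD.
    (* The total sign is thus independent of the simplex and of [Y]. *)
    have -> : (#|Y| + k)%N = d.
      by apply/succn_inj; rewrite -cJY /= /k -addnS prednK ?card_gt0 // addnC.
    by rewrite mulrC mulrzA.
  rewrite (points_set0 D (bS _ JS) _ JY) // mulr0n mul0rz ifF ?horner0 ?mulr0z //.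
  by apply/negP => /goodP[_ _]; rewrite JY eqxx.
Qed.

End Main.

Theorem theorem1p1 (R : realType) (d : nat) (A : zmodType)
    (v : set 'rV[R]_d -> A)
    (v_valuation : valuation (@cone_lattice R d) v)
    (v_empty : v set0 = 0)
    (P : set 'rV[R]_d)
    (P_polytope : convex_polytope P)
    (P_closed : closed P)
    (P_dim : has_dim P d)
    (P_rational : rational_vertices P) :
  exists Q : group_quasi_poly A d,
    [/\ forall t : nat, (0 < t)%N -> gqp_eval Q t%:Z = V v P t,
        infinite_order (v setT) -> gqp_degree_exact Q,
        (gqp_period Q %| denominator P)%N,
        integral_vertices P -> gqp_polynomial Q
      & forall t : nat, (0 < t)%N ->
          gqp_eval Q (- t%:Z) = V v (opp_set (relint P)) t *~ (-1) ^+ d].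
Proof.
have hullT := has_dim_full P_dim; have [polyP bP] := P_polytope.
(* A point of [P] is the [p] towards which [closed_polyhedron] contracts. *)
have P0 : P !=set0 by exact: affine_hull_nonempty hullT.
have [N [a [b [a0 PE]]]] := closed_polyhedron polyP P_closed P0.
rewrite PE in bP hullT P_rational *; rewrite (relint_polyhedron a0 hullT).
exact: polyhedron_reciprocity.
Qed.
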